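(* Let the function symbol $f$ be interpreted in $K(M_{n,\lfloor n/2\rfloor},F_{\mathrm{nb}},G_{\mathrm{nb}})$ by any $\Theta\in G_{\mathrm{nb}}$. Then all the axioms of $\forall\mathrm{PV}_1(f)$ are valid (i.e. have truth value $\mathbf 1$) in $K(M_{n,\lfloor n/2\rfloor},F_{\mathrm{nb}},G_{\mathrm{nb}})$.
   Context: Setup. $L_{all}$ is the first-order language with a name for every relation and function on $\mathbb N$. Fix an $\aleph_1$-saturated nonstandard model $\mathcal M$ of the true theory $\mathrm{Th}_{L_{all}}(\mathbb N)$, with $\mathbb N\subseteq\mathcal M$ as an initial segment, and a nonstandard number $n\in\mathcal M\setminus\mathbb N$ which is a power of two. Finite sets, functions, sequences and trees are coded by numbers; for a coded set $S$, $|S|\in\mathcal M$ is its cardinality. Any sequence of standard finite objects has a value at index $n$ in $\mathcal M$ (via the corresponding function symbol of $L_{all}$). $\mathrm{st}$ is the standard part of finite $\mathcal M$-rationals; an $\mathcal M$-rational $q$ is infinitesimal if $|q|<1/k$ for all standard $k\ge1$. $\mathcal M_n\subseteq\mathcal M$ is the set of numbers bounded above by $2^{n^{1/t}}$ for some $t\in\mathcal M\setminus\mathbb N$. $L_n\subseteq L_{all}$ consists of all relation symbols and all function symbols whose values on tuples from $\mathcal M_n$ lie in $\mathcal M_n$ (in particular all polynomially bounded functions); $\mathcal M_n$ is regarded as an $L_n$-structure. $\langle i,j\rangle$ is a pairing function on $\mathcal M_n$. Sample space. $M_{k,\lfloor k/2\rfloor}$ is the set of all $\{E\}$-structures on $\{0,\dots,k-1\}$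 in which $E$ is the graph of a function from $\{0,\dots,k-1\}$ to $\{0,\dots,\lfloor k/2\rfloor-1\}$; $M_{n,\lfloor n/2\rfloor}$ is its value at index $n$. For $\omega\in M_{n,\lfloor n/2\rfloor}$ the neighbor of $i<n$ in $\omega$ is the image of $i$ under the function whose graph is $\omega$. Boolean algebra. $\mathcal A$ is the algebra of subsets of $M_{n,\lfloor n/2\rfloor}$ coded in $\mathcal M$, $\mathcal I$ the ideal of those $A$ with $|A|/|M_{n,\lfloor n/2\rfloor}|$ infinitesimal, and $\mathcal B=\mathcal A/\mathcal I$, a complete Boolean algebra with least element $\mathbf 0$, greatest element $\mathbf 1$ and measure $\mu(A/\mathcal I)=\mathrm{st}(|A|/|M_{n,\lfloor n/2\rfloor}|)$. Trees. $\mathcal T_{\mathrm{nb}}$ is the set of all labeled rooted trees coded in $\mathcal M$ such that: each non-leaf node is labeled by some $v\in\{0,\dots,n-1\}$ and has for each $u\in\{0,\dots,n-1\}$ an outgoing edge labeled $u$; each leaf is labeled by an element of $\mathcal M_n$; the depth is at most $n^{1/t}$ (rounded) for some $t\in\mathcal M\setminus\mathbb N$. The computation of $T$ on $\omega$ starts at the root and at a node labeled $v$ follows the edge labeled by the neighbor of $v$ in $\omega$ until a leaf is reached; its label is $T(\omega)$. $F_{\mathrm{nb}}$ is the set of all functions on $M_{n,\lfloor n/2\rfloor}$ computed by trees in $\mathcal T_{\mathrm{nb}}$. Random functions. A $k$-ary random function $\Theta$ assigns to each $\omega$ a $k$-ary function $\Theta_\omega$ coded in $\mathcal M$ with arguments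 from a domain of $k$-tuples from $\mathcal M_n$ and values in $\mathcal M_n$; outside its domain $\Theta_\omega$ is evaluated as $0$; for $\alpha_0,\dots,\alpha_{k-1}\in F_{\mathrm{nb}}$, $\Theta(\alpha_0,\dots,\alpha_{k-1})$ is the function $\omega\mapsto\Theta_\omega(\alpha_0(\omega),\dots,\alpha_{k-1}(\omega))$. $G_{\mathrm{nb}}$ is the family of all random functions on $M_{n,\lfloor n/2\rfloor}$ such that: for each unary $\Theta\in G_{\mathrm{nb}}$ there is a tuple $(\gamma_0,\dots,\gamma_{m-1})$, $m\in\mathcal M_n$, coded by an element of $\mathcal M$, with all $\gamma_i\in F_{\mathrm{nb}}$ and, for all $\alpha\in F_{\mathrm{nb}}$, $\Theta(\alpha)(\omega)=\gamma_{\alpha(\omega)}(\omega)$ if $\alpha(\omega)<m$ and $0$ otherwise; for each $k$-ary $\Theta\in G_{\mathrm{nb}}$, $k>1$, there is a $(k-1)$-ary $\Theta'\in G_{\mathrm{nb}}$ with $\Theta(\alpha_0,\dots,\alpha_{k-1})=\Theta'(\alpha_0,\dots,\alpha_{k-3},\langle\alpha_{k-2},\alpha_{k-1}\rangle)$ for all $\alpha_i\in F_{\mathrm{nb}}$. The structure $K(M_{n,\lfloor n/2\rfloor},F_{\mathrm{nb}},G_{\mathrm{nb}})$ is $\mathcal B$-valued, with number sort $F_{\mathrm{nb}}$ and set sort $G_{\mathrm{nb}}$; function symbols of $L_n$ act pointwise in $\omega$; $[\![\alpha=\beta]\!]=\{\omega:\alpha(\omega)=\beta(\omega)\}/\mathcal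 I$; $[\![R(\alpha_0,\dots,\alpha_{k-1})]\!]=\{\omega:\mathcal M_n\models R(\alpha_0(\omega),\dots,\alpha_{k-1}(\omega))\}/\mathcal I$ for relation symbols $R\in L_n$; $[\![-]\!]$ commutes with $\neg,\wedge,\vee$; $\forall x,\exists x$ are interpreted by $\bigwedge_{\alpha\in F_{\mathrm{nb}}},\bigvee_{\alpha\in F_{\mathrm{nb}}}$ (and set quantifiers by $\bigwedge,\bigvee$ over $G_{\mathrm{nb}}$). The theory $\forall\mathrm{PV}_1(f)$. A function on numbers is polynomially bounded if the length of its output is bounded by a polynomial in the lengths of its inputs. The language $L_{\mathrm{PV}(f)}$ contains a name for every polynomial-time algorithm (running in time bounded by a fixed standard polynomial in the lengths of its inputs) with oracle access to a polynomially bounded function $f$. $\forall\mathrm{PV}_1(f)$ is the set of all universal $L_{\mathrm{PV}(f)}$-sentences that are true in $\mathbb N$ for every interpretation of $f$ as a polynomially bounded function. When $f$ is interpreted by $\Theta\in G_{\mathrm{nb}}$ (of the same arity), a symbol of $L_{\mathrm{PV}(f)}$ naming an oracle algorithm $P$ is interpreted in $K(M_{n,\lfloor n/2\rfloor},F_{\mathrm{nb}},G_{\mathrm{nb}})$ samplewise: it maps $\alpha_0,\dots,\alpha_{k-1}\in F_{\mathrm{nb}}$ to the function $\omega\mapsto P^{\Theta_\omega}(\alpha_0(\omega),\dots,\alpha_{k-1}(\omega))$, computed in $\mathcal M$. *)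

(* Defs.v *)
From mathcomp Require Import all_boot.
From mathcomp Require Import boolp classical_sets cardinality.
Set Implicit Arguments.
Unset Strict Implicit.
Unset Printing Implicit Defensive.

Local Open Scope classical_set_scope.
Local Open Scope nat_scope.

(* Tuples of length [k] over [A] are functions ['I_k -> A]. *)
Definition vnil {A : Type} : 'I_0 -> A :=
  fun i => False_rect A (notF (ltn_ord i)).

Definition vcons {A : Type} {m : nat} (a : A) (v : 'I_m -> A) : 'I_m.+1 -> A :=
  fun i => if unlift ord0 i is Some j then v j else a.

Definition vtail {A : Type} {m : nat} (v : 'I_m.+1 -> A) : 'I_m -> A :=
  fun i => v (lift ord0 i).

Record language := Language { fsym : nat -> Type; rsym : nat -> Type }.

Inductive term (L : language) (m : nat) : Type :=
| Var of 'I_m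
| App (k : nat) of fsym L k & ('I_k -> term L m).

(* [formula L m]: formulas with free variables among ['I_m]; a quantifier binds
   the variable [ord0] and shifts the others by [lift ord0].  In particular
   [formula L 0] is the type of sentences. *)
Inductive formula (L : language) : nat -> Type :=
| Eq m of term L m & term L m : formula L m
| Rel m (k : nat) of rsym L k & ('I_k -> term L m) : formula L m
| Not m of formula L m : formula L m
| And m of formula L m & formula L m : formula L m
| Or m of formula L m & formula L m : formula L m
| All m of formula L m.+1 : formula L m
| Ex m of formula L m.+1 : formula L m.

Fixpoint quantifier_free L m (phi : formula L m) : Prop :=
  match phi with
  | Eq _ _ _ | Rel _ _ _ _ => True
  | Not _ p => quantifier_free p
  | And _ p q | Or _ p q => quantifier_free p /\ quantifier_free q
  | All _ _ | Ex _ _ => False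
  end.

Fixpoint universal L m (phi : formula L m) : Prop :=
  match phi with
  | All _ p => universal p
  | p => quantifier_free p
  end.

Record structure (L : language) (A : Type) := Structure {
  fint : forall k, fsym L k -> ('I_k -> A) -> A;
  rint : forall k, rsym L k -> ('I_k -> A) -> Prop
}.

Fixpoint teval L A (S : structure L A) m (v : 'I_m -> A) (t : term L m) : A :=
  match t with
  | Var i => v i
  | App k s ts => fint S s (fun i => teval S v (ts i))
  end.

Fixpoint sat L A (S : structure L A) m (phi : formula L m) :
    ('I_m -> A) -> Prop :=
  match phi in formula _ m return ('I_m -> A) -> Prop with
  | Eq _ t u => fun v => teval S v t = teval S v u
  | Rel _ k R ts => fun v => rint S R (fun i => teval S v (ts i))
  | Not _ p => fun v => ~ sat S p v
  | And _ p q => fun v => sat S p v /\ sat S q v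
  | Or _ p q => fun v => sat S p v \/ sat S q v
  | All _ p => fun v => forall a, sat S p (vcons a v)
  | Ex _ p => fun v => exists a, sat S p (vcons a v)
  end.

(* A formula in the variable [ord0], the other variables being replaced by
   parameters from [A]. *)
Definition pformula (L : language) (A : Type) :=
  {m : nat & (formula L m.+1 * ('I_m -> A))%type}.

Definition psat L A (S : structure L A) (p : pformula L A) (a : A) : Prop :=
  sat S (projT2 p).1 (vcons a (projT2 p).2).

Definition aleph1_saturated L A (S : structure L A) : Prop :=
  forall C : set A, countable C ->
  forall p : set (pformula L A),
    (forall phi, p phi -> forall i, C ((projT2 phi).2 i)) ->
    (forall q, finite_set q -> q `<=` p ->
       exists a, forall phi, q phi -> psat S phi a) ->
    exists a, forall phi, p phi -> psat S phi a.

Definition Lall : language :=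
  Language (fun k => ('I_k -> nat) -> nat) (fun k => ('I_k -> nat) -> Prop).

Definition stdN : structure Lall nat :=
  @Structure Lall nat (fun k F => F) (fun k R => R).

(* The finite set coded by [s] is the set of positions of the digit 1 in the
   binary expansion of [s]; every finite set of numbers has exactly one code. *)
Definition bmem (x s : nat) : bool := odd (s %/ 2 ^ x).
Definition bcard (s : nat) : nat := count (bmem^~ s) (iota 0 s).

(* Cantor's pairing function, a bijection. *)
Definition pairn (i j : nat) : nat := 'C((i + j).+1, 2) + j.

Fixpoint tuple_code (s : seq nat) : nat :=
  match s with
  | [::] => 0
  | x :: s' => if s' is [::] then x else pairn x (tuple_code s')
  end.

Definition vcode k (v : 'I_k -> nat) : nat := tuple_code (codom v).

(* A finite function is coded as its graph; its value outside of its domain is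
   read as 0. *)
Definition is_function (g : nat) : Prop :=
  forall x y z, bmem (pairn x y) g -> bmem (pairn x z) g -> y = z.
Definition fapp (g x : nat) : nat :=
  head 0 [seq y <- iota 0 g | bmem (pairn x y) g].

(* The code of the [E]-structure on [{0, ..., k-1}] in which [E] is the graph of
   [h]. *)
Definition graph k (h : {ffun 'I_k -> 'I_(k./2)}) : nat :=
  \sum_(i < k) 2 ^ pairn i (h i).

(* A code of a set: the summands are distinct powers of 2. *)
Definition samples (k : nat) : nat :=
  \sum_(h : {ffun 'I_k -> 'I_(k./2)}) 2 ^ graph h.

(* [iroot x t] is the integer part of the [t]-th root of [x]. *)
Definition iroot (x t : nat) : nat := \max_(y < x.+1 | y ^ t <= x) y.

(* In [GenTree.Node v ch] the number [v] is the label of the node and the edge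
   labeled [u] leads to the [u]-th element of [ch]. *)
Definition tree := GenTree.tree nat.

Definition tree_of_code (c : nat) : tree :=
  odflt (GenTree.Leaf 0) (unpickle c).

Fixpoint tree_wf (k : nat) (T : tree) : bool :=
  match T with
  | GenTree.Leaf _ => true
  | GenTree.Node v ch => [&& v < k, size ch == k & all (tree_wf k) ch]
  end.

Fixpoint tree_depth (T : tree) : nat :=
  match T with
  | GenTree.Leaf _ => 0
  | GenTree.Node _ ch => (foldr maxn 0 (map tree_depth ch)).+1
  end.

Fixpoint tree_leaves (T : tree) : seq nat :=
  match T with
  | GenTree.Leaf a => [:: a]
  | GenTree.Node _ ch => flatten (map tree_leaves ch)
  end.

Fixpoint tree_run (neighbor : nat -> nat) (T : tree) : nat :=
  match T with
  | GenTree.Leaf a => a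
  | GenTree.Node v ch => nth 0 (map (tree_run neighbor) ch) (neighbor v)
  end.

(* The length of [x] in binary, i.e. the least [l] with [x < 2 ^ l]. *)
Definition blen (x : nat) : nat := up_log 2 x.+1.
Definition vlen k (x : 'I_k -> nat) : nat := \sum_(i < k) blen (x i).

Definition poly_bounded r (f : ('I_r -> nat) -> nat) : Prop :=
  exists c, forall x, blen (f x) <= c + vlen x ^ c.

(* [None] is the blank symbol. *)
Definition symbol := option bool.

Inductive move := MoveLeft | Stay | MoveRight.

Record tape := Tape { head_pos : nat; cells : seq symbol }.

Definition tape_read (T : tape) : symbol := nth None (cells T) (head_pos T).

Definition tape_act (a : symbol * move) (T : tape) : tape :=
  Tape (match a.2 with
        | MoveLeft => (head_pos T).-1
        | Stay => head_pos T
        | MoveRight => (head_pos T).+1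
        end)
       (set_nth None (cells T) (head_pos T) a.1).

(* Numbers are written in binary, least significant bit in the leftmost cell. *)
Definition tape_of (x : nat) : tape :=
  Tape 0 [seq Some (bmem i x) | i <- iota 0 (blen x)].

Fixpoint read_number (s : seq symbol) : nat :=
  if s is Some b :: s' then b + (read_number s').*2 else 0.

Definition tape_number (T : tape) : nat := read_number (cells T).

Inductive tape_name (k r w : nat) :=
| InputTape of 'I_k
| QueryTape of 'I_r
| AnswerTape
| OutputTape
| WorkTape of 'I_w.
Arguments AnswerTape {k r w}.
Arguments OutputTape {k r w}.

(* [k] is the number of inputs and [r] the arity of the oracle. *)
Record machine (k r : nat) := Machine {
  work_tapes : nat;
  nb_states : nat;
  start_state : 'I_nb_states;
  halt_state : 'I_nb_states;
  query_state : 'I_nb_states;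
  answer_state : 'I_nb_states;
  delta : 'I_nb_states -> (tape_name k r work_tapes -> symbol) ->
          'I_nb_states * (tape_name k r work_tapes -> symbol * move)
}.

Record config k r (P : machine k r) := Config {
  state : 'I_(nb_states P);
  tapes : tape_name k r (work_tapes P) -> tape
}.

Definition init k r (P : machine k r) (x : 'I_k -> nat) : config P :=
  Config (start_state P)
    (fun j => if j is InputTape i then tape_of (x i) else Tape 0 [::]).

(* In the query state the oracle writes its answer on the answer tape in one
   step; the machine has to read it cell by cell. *)
Definition step k r (P : machine k r) (f : ('I_r -> nat) -> nat)
    (c : config P) : config P :=
  if state c == halt_state P then c
  else if state c == query_state P then
    Config (answer_state P)
      (fun j => if j is AnswerTape
                then tape_of (f (fun i => tape_number (tapes c (QueryTape _ _ i))))
                else tapes c j)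
  else
    let d := delta (state c) (fun j => tape_read (tapes c j)) in
    Config d.1 (fun j => tape_act (d.2 j) (tapes c j)).

Definition run k r (P : machine k r) (f : ('I_r -> nat) -> nat)
    (x : 'I_k -> nat) (t : nat) : config P :=
  iter t (step f) (init P x).

(* Every polynomial in the total length [l] of the inputs is bounded by
   [c + l ^ c] for some [c]. *)
Record poly_time_algorithm (k r : nat) := PolyTimeAlgorithm {
  mach : machine k r;
  exponent : nat;
  time_bound (x : 'I_k -> nat) := exponent + vlen x ^ exponent;
  halts_in_time : forall f x, poly_bounded f ->
    state (run mach f x (time_bound x)) = halt_state mach
}.

Definition alg_value k r (P : poly_time_algorithm k r)
    (f : ('I_r -> nat) -> nat) (x : 'I_k -> nat) : nat :=
  tape_number (tapes (run (mach P) f x (time_bound P x)) OutputTape).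

Inductive pv_symbol (r : nat) : nat -> Type :=
| SymF : pv_symbol r r
| SymAlg k of poly_time_algorithm k r : pv_symbol r k.

Definition pv_value r k (s : pv_symbol r k) (f : ('I_r -> nat) -> nat) :
    ('I_k -> nat) -> nat :=
  match s in pv_symbol _ k return ('I_k -> nat) -> nat with
  | SymF => f
  | SymAlg k P => alg_value P f
  end.

(* [r] is the arity of [f]. *)
Definition LPV (r : nat) : language := Language (pv_symbol r) (fun _ => void).

Definition pv_std r (f : ('I_r -> nat) -> nat) : structure (LPV r) nat :=
  @Structure (LPV r) nat (fun k (s : pv_symbol r k) => pv_value s f)
    (fun k (R : void) => of_void _ R).

Definition forallPV1 (r : nat) (phi : formula (LPV r) 0) : Prop :=
  universal phi /\
  forall f : ('I_r -> nat) -> nat, poly_bounded f -> sat (pv_std f) phi vnil.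

Section Model.
Variables (M : Type) (I : structure Lall M) (n : M).

Definition app0 (c : nat) : M := @fint Lall M I 0 (fun _ => c) vnil.
Definition app1 (F : nat -> nat) (x : M) : M :=
  @fint Lall M I 1 (fun v => F (v ord0)) (vcons x vnil).
Definition app2 (F : nat -> nat -> nat) (x y : M) : M :=
  @fint Lall M I 2 (fun v => F (v ord0) (v ord_max)) (vcons x (vcons y vnil)).
Definition rel1 (R : nat -> Prop) (x : M) : Prop :=
  @rint Lall M I 1 (fun v => R (v ord0)) (vcons x vnil).
Definition rel2 (R : nat -> nat -> Prop) (x y : M) : Prop :=
  @rint Lall M I 2 (fun v => R (v ord0) (v ord_max)) (vcons x (vcons y vnil)).

Definition memM : M -> M -> Prop := rel2 bmem.
Definition leM : M -> M -> Prop := rel2 leq.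
Definition ltM : M -> M -> Prop := rel2 (fun x y => x < y).
Definition pairM : M -> M -> M := app2 pairn.
Definition fappM : M -> M -> M := app2 fapp.
Definition vcodeM k (v : 'I_k -> M) : M := @fint Lall M I k (@vcode k) v.

Definition nonstandard (t : M) : Prop := forall k : nat, t <> app0 k.

Definition Mn (x : M) : Prop :=
  exists2 t, nonstandard t & leM x (app2 expn (app0 2) (app2 iroot n t)).

Definition Omega_code : M := app1 samples n.
Definition Omega : Type := {w : M | memM w Omega_code}.

Definition codes (A : M) (P : set Omega) : Prop :=
  (forall x, memM x A -> memM x Omega_code) /\
  (forall w : Omega, memM (sval w) A <-> P w).

Definition coded_sets : set (set Omega) := [set P | exists A, codes A P].

Definition null_sets : set (set Omega) :=
  [set P | exists2 A, codes A P &
     forall k, 0 < k ->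
       ltM (app2 muln (app0 k) (app1 bcard A)) (app1 bcard Omega_code)].

(* Elements of the quotient algebra are the classes of coded sets. *)
Definition Bval : Type := set (set Omega).
Definition cls (P : set Omega) : Bval :=
  [set Q | coded_sets Q /\ null_sets (P `+` Q)].
Definition inB (b : Bval) : Prop := exists2 P, coded_sets P & b = cls P.

Definition B0 : Bval := cls set0.
Definition B1 : Bval := cls setT.
Definition negB (b : Bval) : Bval := [set Q | exists2 P, b P & cls (~` P) Q].
Definition andB (b c : Bval) : Bval :=
  [set Q | exists P P', [/\ b P, c P' & cls (P `&` P') Q]].
Definition orB (b c : Bval) : Bval :=
  [set Q | exists P P', [/\ b P, c P' & cls (P `|` P') Q]].
Definition leB (b c : Bval) : Prop :=
  exists P P', [/\ b P, c P' & null_sets (P `\` P')].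

Definition is_glb (S : set Bval) (b : Bval) : Prop :=
  [/\ inB b, (forall c, S c -> leB b c) &
      forall d, inB d -> (forall c, S c -> leB d c) -> leB d b].
Definition is_lub (S : set Bval) (b : Bval) : Prop :=
  [/\ inB b, (forall c, S c -> leB c b) &
      forall d, inB d -> (forall c, S c -> leB c d) -> leB b d].

(* The algebra is complete, so that the default value is irrelevant. *)
Definition infB (S : set Bval) : Bval := xget B0 (is_glb S).
Definition supB (S : set Bval) : Bval := xget B0 (is_lub S).

Definition Tnb (T : M) : Prop :=
  [/\ rel2 (fun k c => tree_wf k (tree_of_code c)) n T,
      (forall a, rel2 (fun a c => a \in tree_leaves (tree_of_code c)) a T ->
         Mn a) &
      exists2 t, nonstandard t &
        leM (app1 (fun c => tree_depth (tree_of_code c)) T) (app2 iroot n t)].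

Definition tree_value (T : M) (w : Omega) : M :=
  app2 (fun c s => tree_run (fapp s) (tree_of_code c)) T (sval w).

Definition Fnb : set (Omega -> M) :=
  [set alpha | exists2 T, Tnb T & alpha = tree_value T].

(* A random function maps each sample to the code of a finite function. *)
Definition random_function (k : nat) (Theta : Omega -> M) : Prop :=
  forall w,
    rel1 is_function (Theta w) /\
    forall x y, memM (pairM x y) (Theta w) ->
      (exists2 v : 'I_k -> M, (forall i, Mn (v i)) & x = vcodeM v) /\ Mn y.

Definition rapp k (Theta : Omega -> M) (alpha : 'I_k -> Omega -> M) :
    Omega -> M :=
  fun w => fappM (Theta w) (vcodeM (fun i => alpha i w)).

(* The last two entries of the tuple are replaced by their pair. *)
Definition pair_last k (alpha : 'I_k.+2 -> Omega -> M) : 'I_k.+1 -> Omega -> M :=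
  fun i => if i < k then alpha (inord i)
           else fun w => pairM (alpha (inord k) w) (alpha (inord k.+1) w).

(* In the unary case [gamma] codes the tuple whose [i]-th entry is (the code of)
   the function [gamma_i]. *)
Fixpoint Gnb (k : nat) : set (Omega -> M) :=
  match k with
  | 0 => set0
  | 1 => [set Theta | random_function 1 Theta /\
      exists m gamma : M,
        [/\ Mn m,
            forall i, ltM i m ->
              Fnb (fun w => fappM (fappM gamma i) (sval w)) &
            forall alpha, Fnb alpha -> forall w,
              (ltM (alpha w) m ->
                 rapp Theta (fun _ : 'I_1 => alpha) w =
                 fappM (fappM gamma (alpha w)) (sval w)) /\
              (~ ltM (alpha w) m ->
                 rapp Theta (fun _ : 'I_1 => alpha) w = app0 0)]]
  | (k''.+1 as k').+1 => [set Theta | random_function k Theta /\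
      exists2 Theta', Gnb k' Theta' &
        forall alpha : 'I_k''.+2 -> Omega -> M, (forall i, Fnb (alpha i)) ->
          rapp Theta alpha = rapp Theta' (pair_last alpha)]
  end.

Section Samplewise.
(* [S w] interprets the symbols of [L] in [M] for the sample [w]. *)
Variables (L : language) (S : Omega -> structure L M).

Definition samplewise k (s : fsym L k) (alpha : 'I_k -> Omega -> M) :
    Omega -> M :=
  fun w => fint (S w) s (fun i => alpha i w).

(* The function symbols are interpreted by operations on [Fnb]. *)
Definition closed_Fnb : Prop :=
  forall k (s : fsym L k) (alpha : 'I_k -> Omega -> M),
    (forall i, Fnb (alpha i)) -> Fnb (samplewise s alpha).

Fixpoint tvalue m (v : 'I_m -> Omega -> M) (t : term L m) : Omega -> M :=
  match t with
  | Var i => v i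
  | App k s ts => samplewise s (fun i => tvalue v (ts i))
  end.

Fixpoint truth m (phi : formula L m) : ('I_m -> Omega -> M) -> Bval :=
  match phi in formula _ m return ('I_m -> Omega -> M) -> Bval with
  | Eq _ t u => fun v => cls [set w | tvalue v t w = tvalue v u w]
  | Rel _ k R ts => fun v =>
      cls [set w | rint (S w) R (fun i => tvalue v (ts i) w)]
  | Not _ p => fun v => negB (truth p v)
  | And _ p q => fun v => andB (truth p v) (truth q v)
  | Or _ p q => fun v => orB (truth p v) (truth q v)
  | All _ p => fun v => infB [set truth p (vcons alpha v) | alpha in Fnb]
  | Ex _ p => fun v => supB [set truth p (vcons alpha v) | alpha in Fnb]
  end.

End Samplewise.

(* The value in [M] of a symbol of [LPV r], the oracle being the finite [r]-ary
   function coded by [g]; the code is the first argument of the function on the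
   natural numbers that is evaluated in [M]. *)
Definition pv_symbolM r (g : M) k (s : pv_symbol r k) (x : 'I_k -> M) : M :=
  @fint Lall M I k.+1
    (fun v => pv_value s (fun q => fapp (v ord0) (vcode q)) (vtail v))
    (vcons g x).

Definition K_sample r (Theta : Omega -> M) (w : Omega) : structure (LPV r) M :=
  @Structure (LPV r) M (pv_symbolM (Theta w)) (fun k (R : void) => of_void _ R).

Definition K_closed r (Theta : Omega -> M) : Prop :=
  closed_Fnb (K_sample r Theta).

Definition K_truth r (Theta : Omega -> M) (phi : formula (LPV r) 0) : Bval :=
  truth (K_sample r Theta) phi vnil.

End Model.

(* Main.v *)
Require Import Defs.
From mathcomp Require Import all_boot.
From mathcomp Require Import boolp classical_sets cardinality.
From mathcomp Require Import zify.

(** Why the theorem is true.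

    Validity.  The oracle coded by a number [g] is a bounded function, hence
    polynomially bounded, so an axiom [phi] holds in the standard model for
    every [g].  This is one first-order fact about numbers and therefore holds
    in [M] for every [g], in particular for [Theta w] ([pv_axiom_sat]): at each
    single sample [w] the axiom is true for all arguments.  The truth value of
    a quantifier-free formula is the class of the set of samples at which it is
    true ([truth_quantifier_free]); hence every instance of the matrix of [phi]
    has value [B1], and so has the infimum of these values
    ([truth_universal]).

    Closure.  The argument above needs the symbols of the language to be
    operations on [Fnb], which is the combinatorial core ([K_closedP]).  Given
    decision trees for the arguments and for every answer of the oracle, a
    decision tree can simulate the machine: it first computes the arguments,
    then runs the machine and plugs in, at each query, the tree that computes
    the answer ([pv_tree]).  Three facts make the result a tree of the right
    size.
    - The numbers below the [t]-th root of [n] for some nonstandard [t] are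
      those all of whose standard powers are at most [n]
      ([small_le_iroot], [small_iroot]).  These numbers, called small here,
      contain the standard ones and are closed under sums and products, and
      the cost of the simulation is a standard polynomial in the bounds for
      the given trees.
    - Iterated pairing turns [Theta] into a unary random function, and testing
      that one on constants shows that the answers are given by a coded
      sequence of members of [Fnb] ([Gnb_table]).  Being coded, the sequence
      has an entry that needs the largest trees, so a single small bound
      serves for all entries ([uniform_table]).
    - A machine cannot write queries longer than its running time, so it only
      sees the values of [Theta w] on tuples from [Mn], and there they agree
      with the coded sequence ([pv_symbol_table]).

    All the finite combinatorics is done with ordinary numbers and then
    carried over to [M] by the tactic [transfer]. *)

Set Implicit Arguments.
Unset Strict Implicit.
Unset Printing Implicit Defensive.

(** * Tuples *)

Lemma vcons0 A m (a : A) (v : 'I_m -> A) : vcons a v ord0 = a.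
Proof. by rewrite /vcons unlift_none. Qed.

Lemma vconsS A m (a : A) (v : 'I_m -> A) i : vcons a v (lift ord0 i) = v i.
Proof. by rewrite /vcons liftK. Qed.

Lemma vtail_cons A m (a : A) (v : 'I_m -> A) : vtail (vcons a v) = v.
Proof. by apply/funext => i; rewrite /vtail vconsS. Qed.

Lemma vnilE A (v : 'I_0 -> A) : v = vnil.
Proof. by apply/funext => -[]. Qed.

Lemma vcons_eta A m (v : 'I_m.+1 -> A) : v = vcons (v ord0) (vtail v).
Proof.
by apply/funext => i; case: (unliftP ord0 i) => [j|] ->; rewrite ?vconsS ?vcons0.
Qed.

Lemma vcons_map A B m (f : A -> B) (a : A) (v : 'I_m -> A) :
  (fun i => f (vcons a v i)) = vcons (f a) (fun i => f (v i)).
Proof.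
rewrite [LHS]vcons_eta /vtail vcons0; congr vcons.
by apply/funext => i; rewrite vconsS.
Qed.

Lemma vcons_last2 A (a b : A) : vcons a (vcons b vnil) ord_max = b.
Proof. by rewrite (_ : ord_max = lift ord0 ord0) ?vconsS ?vcons0 //; exact: val_inj. Qed.

(** * Transfer from the standard model *)

Section Transfer.
Variables (M : Type) (I : structure Lall M).
Hypothesis true_theory :
  forall phi : formula Lall 0, sat stdN phi vnil -> sat I phi vnil.

Lemma sat_transfer k (phi : formula Lall k) :
  (forall u, sat stdN phi u) -> forall v, sat I phi v.
Proof.
elim: k phi => [|k IHk] phi Hphi v; first by rewrite (vnilE v); exact: true_theory.
rewrite (vcons_eta v).
by apply: (IHk (All phi)) => u a; exact: Hphi.
Qed.

Lemma sat_transfer_iff k (phi psi : formula Lall k) :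
  (forall u, sat stdN phi u <-> sat stdN psi u) ->
  forall v, sat I phi v = sat I psi v.
Proof.
move=> eq_phi v; apply/propext.
have := @sat_transfer k (Or (And phi psi) (And (Not phi) (Not psi))) _ v.
case => [u|[]|[]] /=; [|by []|by []].
have [] := eq_phi u; case: (pselect (sat stdN phi u)); tauto.
Qed.

(** A frame says how a tuple of numbers is presented as an element of some type.
    Presenting a tuple to which a bound variable has been added as a pair makes
    the reflected statements below read as ordinary statements about numbers:
    looking up a variable is then a projection, which computes. *)
Record frame := Frame {
  frame_type : Type;
  frame_arity : nat;
  frame_read : ('I_frame_arity -> nat) -> frame_type
}.

Definition tuple_frame k : frame := @Frame ('I_k -> nat) k id.

Definition bind_frame (p : frame) : frame :=
  @Frame (frame_type p * nat)%type (frame_arity p).+1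
    (fun u => (frame_read (vtail u), u ord0)).

(** [val_at p v x F] and [holds_at p v P R] tie a term or a statement about [M],
    with the elements of the tuple [v] as parameters, to its counterpart over
    the numbers.  Every connective, quantifier and symbol preserves the two
    relations; the rules below are read backwards to find [F] and [R]. *)
Definition val_at (p : frame) (v : 'I_(frame_arity p) -> M) (x : M)
    (F : frame_type p -> nat) : Prop :=
  x = @fint Lall M I (frame_arity p) (fun u => F (frame_read u)) v.

Definition holds_at (p : frame) (v : 'I_(frame_arity p) -> M) (P : Prop)
    (R : frame_type p -> Prop) : Prop :=
  P = @rint Lall M I (frame_arity p) (fun u => R (frame_read u)) v.

Arguments val_at : clear implicits.
Arguments holds_at : clear implicits.

Notation rel R := (@Rel Lall _ _ R (fun i => Var _ i)).
Notation app F := (@App Lall _ _ F (fun i => Var _ i)).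

(** The last step of a transfer: what the rules have reflected need only be
    proved for numbers. *)
Lemma holds_elim k (v : 'I_k -> M) (P : Prop) (R : ('I_k -> nat) -> Prop) :
  holds_at (tuple_frame k) v P R -> (forall u, R u) -> P.
Proof. by move=> -> HR; exact: (@sat_transfer k (rel R)). Qed.

Lemma val_tuple k (v : 'I_k -> M) i : val_at (tuple_frame k) v (v i) (fun u => u i).
Proof. exact: (@sat_transfer k (Eq (Var _ i) (app (fun u => u i)))). Qed.

Lemma val_here p v a : val_at (bind_frame p) (vcons a v) a (fun u => u.2).
Proof.
have := @sat_transfer _ (Eq (Var _ ord0) (app (fun u => u ord0))) _
  (vcons a v).
by move=> /(_ (fun=> erefl)) /=; rewrite vcons0.
Qed.

Lemma val_weak p v a x F :
  val_at p v x F -> val_at (bind_frame p) (vcons a v) x (fun u => F u.1).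
Proof.
move=> ->; rewrite /val_at /=.
have := @sat_transfer _
  (Eq (@App Lall _ _ (fun u => F (frame_read u)) (fun i => Var _ (lift ord0 i)))
      (app (fun u => F (frame_read (vtail u))))) _ (vcons a v).
move=> /(_ (fun=> erefl)) /= <-; congr fint.
by apply/funext => i; rewrite vconsS.
Qed.

Lemma val_fint p v k (G : ('I_k -> nat) -> nat) x (F : 'I_k -> frame_type p -> nat) :
  (forall i, val_at p v (x i) (F i)) ->
  val_at p v (@fint Lall M I k G x) (fun u => G (fun i => F i u)).
Proof.
move=> HF; rewrite /val_at (funext HF).
exact: (@sat_transfer _ (Eq (@App Lall _ _ G
  (fun i => app (fun u => F i (frame_read u)))) (app _))).
Qed.

Lemma holds_rint p v k (R : ('I_k -> nat) -> Prop) x (F : 'I_k -> frame_type p -> nat) :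
  (forall i, val_at p v (x i) (F i)) ->
  holds_at p v (@rint Lall M I k R x) (fun u => R (fun i => F i u)).
Proof.
move=> HF; rewrite /holds_at (funext HF).
exact: (@sat_transfer_iff _ (@Rel Lall _ _ R
  (fun i => app (fun u => F i (frame_read u)))) (rel _)).
Qed.

Lemma holds_eq p v x y (F G : frame_type p -> nat) :
  val_at p v x F -> val_at p v y G -> holds_at p v (x = y) (fun u => F u = G u).
Proof.
move=> -> ->.
exact: (@sat_transfer_iff _ (Eq (app (fun u => F (frame_read u)))
  (app (fun u => G (frame_read u)))) (rel _)).
Qed.

Lemma holds_not p v P (R : frame_type p -> Prop) :
  holds_at p v P R -> holds_at p v (~ P) (fun u => ~ R u).
Proof.
move=> HP; rewrite /holds_at HP.
exact: (@sat_transfer_iff _ (Not (rel (fun u => R (frame_read u)))) (rel _)).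
Qed.

Lemma holds_and p v P Q (R S : frame_type p -> Prop) :
  holds_at p v P R -> holds_at p v Q S -> holds_at p v (P /\ Q) (fun u => R u /\ S u).
Proof.
move=> HP HQ; rewrite /holds_at HP HQ.
exact: (@sat_transfer_iff _ (And (rel (fun u => R (frame_read u)))
  (rel (fun u => S (frame_read u)))) (rel _)).
Qed.

Lemma holds_and3 p v P Q P' (R S R' : frame_type p -> Prop) :
  holds_at p v P R -> holds_at p v Q S -> holds_at p v P' R' ->
  holds_at p v [/\ P, Q & P'] (fun u => [/\ R u, S u & R' u]).
Proof.
have and3E (A B C : Prop) : [/\ A, B & C] = (A /\ B /\ C).
  by apply/propext; split=> [[]|[? []]].
move=> HP HQ HP'; rewrite and3E.
by under [X in holds_at _ _ _ X]funext do rewrite and3E; do 2!apply: holds_and => //.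
Qed.

Lemma holds_or p v P Q (R S : frame_type p -> Prop) :
  holds_at p v P R -> holds_at p v Q S -> holds_at p v (P \/ Q) (fun u => R u \/ S u).
Proof.
move=> HP HQ; rewrite /holds_at HP HQ.
exact: (@sat_transfer_iff _ (Or (rel (fun u => R (frame_read u)))
  (rel (fun u => S (frame_read u)))) (rel _)).
Qed.

Lemma holds_imp p v (P Q : Prop) (R S : frame_type p -> Prop) :
  holds_at p v P R -> holds_at p v Q S -> holds_at p v (P -> Q) (fun u => R u -> S u).
Proof.
move=> HP HQ; have := holds_or (holds_not HP) HQ; rewrite /holds_at.
rewrite (_ : (fun u => R (frame_read u) -> S (frame_read u)) =
             (fun u => ~ R (frame_read u) \/ S (frame_read u))); last first.
  by apply/funext => u; apply/propext; case: (pselect (R (frame_read u))); tauto.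
by move=> <-; apply/propext; case: (pselect P); tauto.
Qed.

Lemma holds_iff p v P Q (R S : frame_type p -> Prop) :
  holds_at p v P R -> holds_at p v Q S -> holds_at p v (P <-> Q) (fun u => R u <-> S u).
Proof. by move=> HP HQ; apply: holds_and; apply: holds_imp. Qed.

Lemma holds_forall p v (P : M -> Prop) (R : frame_type p * nat -> Prop) :
  (forall a, holds_at (bind_frame p) (vcons a v) (P a) R) ->
  holds_at p v (forall a, P a) (fun u => forall b, R (u, b)).
Proof.
move=> HP; pose R' (u : 'I_(frame_arity p).+1 -> nat) := R (frame_read (vtail u), u ord0).
have := @sat_transfer_iff (frame_arity p) (All (rel R'))
  (rel (fun u => forall b, R (frame_read u, b))) _ v.
rewrite /holds_at => /= <-.
  by apply/propext; split=> H a; have := H a; rewrite HP.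
by move=> u; split=> H b; have := H b; rewrite /R' vtail_cons vcons0.
Qed.

Lemma holds_exists p v (P : M -> Prop) (R : frame_type p * nat -> Prop) :
  (forall a, holds_at (bind_frame p) (vcons a v) (P a) R) ->
  holds_at p v (exists a, P a) (fun u => exists b, R (u, b)).
Proof.
move=> HP.
have exE A (Q : A -> Prop) : (exists a, Q a) = (~ forall a, ~ Q a).
  apply/propext; split=> [[a Qa] /(_ a) //|NQ].
  by apply: contrapT => nQ; apply: NQ => a Qa; apply: nQ; exists a.
have := holds_not (holds_forall (fun a => holds_not (HP a))).
rewrite /holds_at exE => ->; congr rint.
by apply/funext => u; rewrite exE.
Qed.

Lemma holds_ord p v k (P : 'I_k -> Prop) (R : 'I_k -> frame_type p -> Prop) :
  (forall i, holds_at p v (P i) (R i)) ->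
  holds_at p v (forall i, P i) (fun u => forall i, R i u).
Proof.
elim: k P R => [|k IHk] P R HP.
  apply/propext; split=> [_|_ [] //]; apply: (@sat_transfer _ (rel _)) => u /= [] //.
have := holds_and (HP ord0) (IHk _ _ (fun i => HP (lift ord0 i))).
have split_ord (Q : 'I_k.+1 -> Prop) :
    (forall i, Q i) <-> Q ord0 /\ forall i, Q (lift ord0 i).
  split=> [HQ|[HQ0 HQ] i]; first by split.
  by case: (unliftP ord0 i) => [j|] ->.
rewrite /holds_at (propext (split_ord P)) => ->.
suff -> : (fun u => forall i, R i (frame_read u)) =
  (fun u => R ord0 (frame_read u) /\ forall i, R (lift ord0 i) (frame_read u)) by [].
by apply/funext => u; apply/propext; exact: split_ord.
Qed.

Lemma val_vcons p v k x (y : 'I_k -> M) F (G : 'I_k -> frame_type p -> nat) :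
  val_at p v x F -> (forall i, val_at p v (y i) (G i)) ->
  forall i, val_at p v (vcons x y i)
              (fun u => vcons (F u) (fun j => G j u) i).
Proof.
move=> HF HG i.
have -> : (fun u => vcons (F u) (fun j => G j u) i) = vcons F G i.
  by apply/funext => u; rewrite -(vcons_map (fun h => h u)).
by case: (unliftP ord0 i) => [j|] ->; rewrite ?vconsS ?vcons0.
Qed.

Lemma val_if p v (b : bool) x y F G :
  val_at p v x F -> val_at p v y G ->
  val_at p v (if b then x else y) (fun u => if b then F u else G u).
Proof. by case: b. Qed.

Lemma val_vnil p v i : val_at p v (vnil i) (fun=> vnil i).
Proof. by case: i. Qed.

Lemma val_app0 p v c : val_at p v (app0 I c) (fun=> c).
Proof. exact: (val_fint (fun=> c) (@val_vnil p v)). Qed.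

Lemma val_app1 p v f x (F : frame_type p -> nat) :
  val_at p v x F -> val_at p v (app1 I f x) (fun u => f (F u)).
Proof.
move=> HF.
have -> : (fun u => f (F u)) = (fun u => f (vcons (F u) vnil ord0)).
  by apply/funext => u; rewrite vcons0.
exact: (val_fint (fun y : 'I_1 -> nat => f (y ord0)) (val_vcons HF (@val_vnil p v))).
Qed.

Lemma vcons_pairE X T (f : nat -> nat -> T) (F G : X -> nat) :
  (fun u => f (F u) (G u)) =
  (fun u => let y := vcons (F u) (vcons (G u) vnil) in f (y ord0) (y ord_max)).
Proof. by apply/funext => u /=; rewrite vcons_last2 vcons0. Qed.

Lemma val_app2 p v f x y (F G : frame_type p -> nat) :
  val_at p v x F -> val_at p v y G -> val_at p v (app2 I f x y) (fun u => f (F u) (G u)).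
Proof.
move=> HF HG; rewrite vcons_pairE.
exact: (val_fint (fun y : 'I_2 -> nat => f (y ord0) (y ord_max))
  (val_vcons HF (val_vcons HG (@val_vnil p v)))).
Qed.

Lemma holds_rel1 p v R x (F : frame_type p -> nat) :
  val_at p v x F -> holds_at p v (rel1 I R x) (fun u => R (F u)).
Proof.
move=> HF.
have -> : (fun u => R (F u)) = (fun u => R (vcons (F u) vnil ord0)).
  by apply/funext => u; rewrite vcons0.
exact: (holds_rint (fun y : 'I_1 -> nat => R (y ord0)) (val_vcons HF (@val_vnil p v))).
Qed.

Lemma holds_rel2 p v (R : nat -> nat -> Prop) x y (F G : frame_type p -> nat) :
  val_at p v x F -> val_at p v y G -> holds_at p v (rel2 I R x y) (fun u => R (F u) (G u)).
Proof.
move=> HF HG; rewrite vcons_pairE.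
exact: (holds_rint (fun y : 'I_2 -> nat => R (y ord0) (y ord_max))
  (val_vcons HF (val_vcons HG (@val_vnil p v)))).
Qed.

End Transfer.

Arguments val_at {M} I p v x F.
Arguments holds_at {M} I p v P R.

(** The tactics apply the rules backwards and instantiate the unknown function
    or relation over the numbers on the way.  A variable is found by peeling
    the binders that were passed after it. *)
Ltac reflect_val T :=
  lazymatch goal with
  | |- @val_at _ _ _ _ (vcons _ _ _) _ =>
      refine (val_vcons _ _ _); [reflect_val T | intro; reflect_val T]
  | |- @val_at _ _ _ _ (if _ then _ else _) _ =>
      refine (val_if _ _ _); reflect_val T
  | |- @val_at _ _ _ _ (vnil _) _ => refine (val_vnil _ _ _)
  | |- @val_at _ _ _ _ (app0 _ _) _ => refine (val_app0 T _ _)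
  | |- @val_at _ _ _ _ (app1 _ _ _) _ => refine (val_app1 T _ _); reflect_val T
  | |- @val_at _ _ _ _ (app2 _ _ _ _) _ =>
      refine (val_app2 T _ _ _); reflect_val T
  | |- @val_at _ _ _ _ (fint _ _ _) _ =>
      refine (val_fint T _ _); intro; reflect_val T
  | |- _ => first [ refine (val_here T _ _) | refine (val_tuple T _ _)
                  | refine (val_weak T _ _); reflect_val T ]
  end.

Ltac reflect_prop T :=
  lazymatch goal with
  | |- @holds_at _ _ _ _ (_ /\ _) _ => refine (holds_and T _ _); reflect_prop T
  | |- @holds_at _ _ _ _ [/\ _, _ & _] _ =>
      refine (holds_and3 T _ _ _); reflect_prop T
  | |- @holds_at _ _ _ _ (_ \/ _) _ => refine (holds_or T _ _); reflect_prop T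
  | |- @holds_at _ _ _ _ (_ <-> _) _ => refine (holds_iff T _ _); reflect_prop T
  | |- @holds_at _ _ _ _ (~ _) _ => refine (holds_not T _); reflect_prop T
  | |- @holds_at _ _ _ _ (_ = _) _ => refine (holds_eq T _ _); reflect_val T
  | |- @holds_at _ _ _ _ (rel1 _ _ _) _ => refine (holds_rel1 T _ _); reflect_val T
  | |- @holds_at _ _ _ _ (rel2 _ _ _ _) _ =>
      refine (holds_rel2 T _ _ _); reflect_val T
  | |- @holds_at _ _ _ _ (ex _) _ =>
      refine (holds_exists T _); intro; reflect_prop T
  | |- _ =>
      first [ refine (holds_forall T _); intro
            | refine (holds_ord T _); intro
            | refine (holds_imp T _ _) ]; reflect_prop T
  end.

(** [transfer_with v] replaces a goal whose only parameters are the entries of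
    the tuple [v] by the same statement about numbers; [transfer] is the case
    without parameters. *)
Ltac transfer_with v :=
  lazymatch goal with
  | T : forall phi : formula Lall 0, sat stdN phi vnil -> sat ?I phi vnil |- _ =>
      rewrite /leM /ltM /memM /pairM /fappM /vcodeM;
      refine (@holds_elim _ I T _ v _ _ _ _); [reflect_prop T | cbn [fst snd]]
  end.
Ltac transfer :=
  lazymatch goal with
  | T : forall phi : formula Lall 0, sat stdN phi vnil -> @sat _ ?M _ _ phi vnil |- _ =>
      transfer_with (@vnil M); move=> _
  end.

(** * Codes of finite sets *)

(** Adding a power of 2 whose digit is 0 causes no carry. *)
Lemma bmem_addX x y s : ~~ bmem y s -> bmem x (2 ^ y + s) = (x == y) || bmem x s.
Proof.
move=> ys; rewrite /bmem; case: (ltngtP x y) => [lt_xy|lt_yx|->] /=.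
- rewrite -(subnK (ltnW lt_xy)) expnD divnMDl ?expn_gt0 // oddD oddX.
  by rewrite subn_eq0 leqNgt lt_xy.
- rewrite -(subnKC lt_yx) expnD expnS (mulnC 2) !divnMA.
  rewrite -{1}[2 ^ y]mul1n divnMDl ?expn_gt0 // add1n.
  move: ys; rewrite /bmem; set a := s %/ 2 ^ y => ys.
  by rewrite !divn2 -uphalfE uphalf_half (negbTE ys).
- by rewrite -{1}[2 ^ y]mul1n divnMDl ?expn_gt0 // add1n /= ys.
Qed.

Lemma bmem_sumX (J : finType) (f : J -> nat) x :
  injective f -> bmem x (\sum_(i : J) 2 ^ f i) <-> exists i, x = f i.
Proof.
move=> f_inj.
have mem_sum (r : seq J) : uniq r ->
    forall y, bmem y (\sum_(i <- r) 2 ^ f i) = (y \in map f r).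
  elim: r => [_ y|j r IHr /= /andP[jr uniq_r] y].
    by rewrite big_nil /bmem div0n.
  by rewrite big_cons bmem_addX ?IHr // mem_map.
rewrite -big_enum mem_sum ?enum_uniq //.
split=> [/mapP[i _ ->]|[i ->]]; first by exists i.
by rewrite map_f // mem_enum.
Qed.

Lemma bmem_lt x s : bmem x s -> x < s.
Proof.
rewrite /bmem; case: (leqP s x) => // le_sx.
by rewrite divn_small // (leq_ltn_trans le_sx) // ltn_expl.
Qed.

(** This is what makes sets of samples defined in [M] coded, after transfer. *)
Lemma comprehension s (P : nat -> Prop) :
  exists A, forall x, bmem x A <-> bmem x s /\ P x.
Proof.
exists (\sum_(y : {y : 'I_s | bmem y s && `[< P y >]}) 2 ^ sval y) => x.
rewrite bmem_sumX; last by move=> y z /val_inj/val_inj.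
split=> [[[y /= /andP[ys /asboolP Py]] ->] //|[xs Px]].
have Hx : bmem (Ordinal (bmem_lt xs)) s && `[< P (Ordinal (bmem_lt xs)) >].
  by rewrite xs; apply/asboolP.
by exists (exist (fun y : 'I_s => bmem y s && `[< P y >]) _ Hx).
Qed.

(** Counting up to any larger bound allows cardinalities of different sets to
    be compared over a common range. *)
Lemma bcard_count_ext s N : bcard s = count (bmem^~ s) (iota 0 (s + N)).
Proof.
rewrite /bcard iotaD count_cat addnC.
rewrite (_ : count _ (iota (0 + s) N) = 0) //.
apply/eqP; rewrite -leqn0 leqNgt -has_count; apply/hasPn => x.
rewrite mem_iota add0n => /andP[le_sx _].
by apply/negP => /bmem_lt; rewrite ltnNge le_sx.
Qed.

Lemma bcard_cover A B C :
  (forall x, bmem x A -> bmem x B \/ bmem x C) -> bcard A <= bcard B + bcard C.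
Proof.
move=> sub; rewrite (bcard_count_ext A (B + C)) (bcard_count_ext B (A + C)).
rewrite (bcard_count_ext C (A + B)).
have -> : B + (A + C) = A + (B + C) by lia.
have -> : C + (A + B) = A + (B + C) by lia.
rewrite -count_predUI (leq_trans _ (leq_addr _ _)) //.
by apply: sub_count => x /= /sub[] -> //; rewrite orbT.
Qed.

Lemma bcard_gt0 x s : bmem x s -> 0 < bcard s.
Proof.
move=> xs; rewrite /bcard -has_count; apply/hasP; exists x => //.
by rewrite mem_iota /= add0n bmem_lt.
Qed.

(** * Pairing *)

Lemma pairn_inj i j i' j' : pairn i j = pairn i' j' -> i = i' /\ j = j'.
Proof.
have step s j0 : j0 <= s -> 'C(s.+1, 2) + j0 < 'C(s.+2, 2).
  by move=> le_js; rewrite (binS s.+1 1) bin1 ltn_add2l.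
have mono s s' : s < s' -> 'C(s.+2, 2) <= 'C(s'.+1, 2).
  by move=> lt_ss; rewrite leq_bin2l.
rewrite /pairn; case: (ltngtP (i + j) (i' + j')) => [lt|lt|E].
- have := leq_trans (step (i + j) j (leq_addl _ _)) (mono _ _ lt); lia.
- have := leq_trans (step (i' + j') j' (leq_addl _ _)) (mono _ _ lt); lia.
- by rewrite E => /addnI eq_j; lia.
Qed.

Lemma pairn_lt d i j : i < 2 ^ d -> j < 2 ^ d -> pairn i j < 2 ^ (d + d + 3).
Proof.
move=> lt_i lt_j; rewrite /pairn bin2 /= !expnD.
set D := 2 ^ d in lt_i lt_j *.
have : ((i + j).+1 * (i + j))./2 <= (i + j).+1 * (i + j) by lia.
have : (i + j).+1 * (i + j) <= (2 * D) * (2 * D) by apply: leq_mul; lia.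
nia.
Qed.

(** * Samples *)

Lemma bmem_graph k (h : {ffun 'I_k -> 'I_(k./2)}) x :
  bmem x (graph h) <-> exists i : 'I_k, x = pairn i (h i).
Proof. by rewrite /graph bmem_sumX // => i j /pairn_inj[/val_inj]. Qed.

Lemma bmem_samples k x :
  bmem x (samples k) <-> exists h : {ffun 'I_k -> 'I_(k./2)}, x = graph h.
Proof.
rewrite /samples bmem_sumX // => h h' eq_hh'; apply/ffunP => i.
have /bmem_graph[j] : bmem (pairn i (h i)) (graph h').
  by rewrite -eq_hh'; apply/bmem_graph; exists i.
by case/pairn_inj => /val_inj <- /val_inj.
Qed.

(** Decision trees branch over the neighbors below [n], so a sample never leaves
    a tree. *)
Lemma sample_bound n w v : bmem w (samples n) -> v < n -> fapp w v < n.
Proof.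
move=> /bmem_samples[h ->] lt_vn; rewrite /fapp.
case E: [seq _ <- _ | _] => [|y s] /=; first lia.
have : y \in [seq y <- iota 0 (graph h) | bmem (pairn v y) (graph h)] by rewrite E mem_head.
rewrite mem_filter => /andP[/bmem_graph[i /pairn_inj[_ ->]] _].
by have := ltn_ord (h i); lia.
Qed.

Lemma samples_gt0 n : 1 < n -> 0 < bcard (samples n).
Proof.
move=> n_gt1; have n2_gt0 : 0 < n./2 by lia.
apply: (@bcard_gt0 (graph [ffun=> Ordinal n2_gt0])).
by apply/bmem_samples; eexists.
Qed.

(** * Codes of tuples *)

Lemma codom_ordS A m (v : 'I_m.+1 -> A) : codom v = v ord0 :: codom (vtail v).
Proof. by rewrite /codom /image_mem enum_ordSl /= -map_comp. Qed.

Lemma codom_ord0 A (v : 'I_0 -> A) : codom v = [::].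
Proof. by apply: size0nil; rewrite size_codom card_ord. Qed.

Lemma vcode1 (v : 'I_1 -> nat) : vcode v = v ord0.
Proof. by rewrite /vcode codom_ordS codom_ord0. Qed.

Lemma codom_mkseq A m (v : 'I_m.+1 -> A) : codom v = mkseq (v \o inord) m.+1.
Proof.
rewrite /mkseq -val_enum_ord -map_comp; apply: eq_map => i.
by rewrite /= inord_val.
Qed.

(** The code of a tuple is an iterated pairing of its entries from the right,
    so that merging the last two entries does not change it. *)
Lemma vcode_pair_last k (q : 'I_k.+2 -> nat) :
  vcode q = vcode (fun i : 'I_k.+1 =>
    if i < k then q (inord i) else pairn (q (inord k)) (q (inord k.+1))).
Proof.
have code_rcons s a b :
    tuple_code (rcons (rcons s a) b) = tuple_code (rcons s (pairn a b)).
  by elim: s => //= x s ->; case: s.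
rewrite /vcode !codom_mkseq !mkseqS /= inordK // ltnn code_rcons.
congr (tuple_code (rcons _ _)); apply/eq_in_map => i.
rewrite mem_iota add0n => /andP[_ lt_ik] /=.
by rewrite inordK ?lt_ik // ltnS ltnW.
Qed.

(** Short tuples and a choice of inverse for [vcode] on them: with [decode] as
    a function symbol, a quantifier over tuples becomes one over codes. *)
Definition short_code r B c :=
  exists2 q : 'I_r -> nat, (forall i, q i < 2 ^ B) & c = vcode q.

Definition decode r B c : 'I_r -> nat :=
  if pselect (short_code r B c) is left H then projT1 (cid2 H) else fun=> 0.

Arguments decode : clear implicits.

Lemma decodeP r B c : short_code r B c ->
  (forall i, decode r B c i < 2 ^ B) /\ c = vcode (decode r B c).
Proof. by rewrite /decode; case: pselect => // H _; case: cid2. Qed.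

(** * Decision trees *)

(** The free monad over queries to the sample: a computation with queries is
    written as an ordinary program with [dbind], whose intermediate results, such
    as configurations of a machine, are labels of leaves. *)
Inductive dtree (A : Type) := DLeaf of A | DAsk of nat & (nat -> dtree A).

Fixpoint drun A (h : nat -> nat) (t : dtree A) : A :=
  match t with DLeaf a => a | DAsk v ch => drun h (ch (h v)) end.

Fixpoint dbind A B (t : dtree A) (k : A -> dtree B) : dtree B :=
  match t with DLeaf a => k a | DAsk v ch => DAsk v (fun u => dbind (ch u) k) end.

Section AsksLe.
Variables (n : nat) (A : Type).

Fixpoint asks_le d (t : dtree A) {struct t} : Prop :=
  match t with
  | DLeaf _ => True
  | DAsk v ch => v < n /\ if d is d'.+1 then forall u, asks_le d' (ch u) else False
  end.

End AsksLe.

Lemma drun_bind A B h (t : dtree A) (k : A -> dtree B) :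
  drun h (dbind t k) = drun h (k (drun h t)).
Proof. by elim: t => //= v ch IH. Qed.

Lemma asks_leW n A d e (t : dtree A) : d <= e -> asks_le n d t -> asks_le n e t.
Proof.
elim: t d e => //= v ch IH [|d] [|e] le_de [lt_v Hch] //.
by split=> // u; exact: IH (Hch u).
Qed.

Lemma asks_le_bind n A B d e (t : dtree A) (k : A -> dtree B) :
  asks_le n d t -> (forall a, asks_le n e (k a)) -> asks_le n (d + e) (dbind t k).
Proof.
move=> + Hk; elim: t d => [a d _|v ch IH [|d] [lt_v // Hch]] /=.
  by apply: asks_leW (Hk a); rewrite leq_addl.
by split=> // u; exact: IH (Hch u).
Qed.

Fixpoint of_tree (T : tree) : dtree nat :=
  match T with
  | GenTree.Leaf a => DLeaf a
  | GenTree.Node v ch => DAsk v (fun u => nth (DLeaf 0) (map of_tree ch) u)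
  end.

(** Leaves are cut off at [B].  Leaves that no sample reaches may carry arbitrary
    labels, and this bounds them without changing the computed function. *)
Fixpoint to_tree n B (t : dtree nat) : tree :=
  match t with
  | DLeaf a => GenTree.Leaf (minn a B)
  | DAsk v ch => GenTree.Node v [seq to_tree n B (ch u) | u <- iota 0 n]
  end.

Lemma drun_of_tree h T : drun h (of_tree T) = tree_run h T.
Proof.
elim: T => //= v ch; elim: ch (h v) => [|T ch IHch] [|u] //=  [] //.
by move=> _; exact: IHch.
Qed.

Lemma asks_le_of_tree n d T :
  tree_wf n T -> tree_depth T <= d -> asks_le n d (of_tree T).
Proof.
elim: T d => //= v ch IH [|d] //; rewrite ltnS => /and3P[-> _] wf_ch le_d; split=> //.
elim: ch IH wf_ch le_d => [_ _ _ [|u] //|T ch IHch /= [IHT IH] /andP[wf_T wf_ch]].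
rewrite geq_max => /andP[le_T le_ch] [|u] /=; first exact: IHT.
exact: IHch.
Qed.

Lemma wf_to_tree n B d t : asks_le n d t -> tree_wf n (to_tree n B t).
Proof.
elim: t d => //= v ch IH [[]//|d] [-> Hch]; rewrite size_map size_iota eqxx /= all_map.
by apply/allP => u _ /=; exact: IH (Hch u).
Qed.

Lemma depth_to_tree n B d t : asks_le n d t -> tree_depth (to_tree n B t) <= d.
Proof.
elim: t d => //= v ch IH [[]//|d] [_ Hch]; rewrite ltnS.
by elim: (iota 0 n) => //= u s IHs; rewrite geq_max IHs andbT; exact: IH (Hch u).
Qed.

Lemma leaves_to_tree n B t a : a \in tree_leaves (to_tree n B t) -> a <= B.
Proof.
elim: t => [b|v ch IH] /=; first by rewrite inE => /eqP ->; exact: geq_minr.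
by elim: (iota 0 n) => //= u s IHs; rewrite mem_cat => /orP[/IH|/IHs].
Qed.

Lemma run_to_tree n B d h t : (forall v, v < n -> h v < n) -> asks_le n d t ->
  tree_run h (to_tree n B t) = minn (drun h t) B.
Proof.
move=> hn; elim: t d => //= v ch IH [[]//|d] [lt_vn Hch].
rewrite -map_comp (nth_map 0) ?size_iota ?hn // nth_iota ?hn //=.
exact: IH (Hch _).
Qed.

Lemma tree_run_leaf h T : tree_run h T = 0 \/ tree_run h T \in tree_leaves T.
Proof.
elim: T => /= [a|v ch]; first by right; rewrite inE.
elim: ch (h v) => [u _|T ch IHch [|u] /= [IHT IH]]; first by left; case: u.
  by case: IHT => [|H]; [left|right; rewrite mem_cat H].
by case: (IHch u IH) => [|H]; [left|right; rewrite mem_cat H orbT].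
Qed.

(** One parameter [d] bounds both the depth and the length of the labels, so that
    a single small number controls a tree. *)
Definition good_tree n T d :=
  [/\ tree_wf n (tree_of_code T), tree_depth (tree_of_code T) <= d &
      forall a, a \in tree_leaves (tree_of_code T) -> a < 2 ^ d].

Lemma good_tree_run n T d h : good_tree n T d -> tree_run h (tree_of_code T) < 2 ^ d.
Proof.
case=> _ _ Hleaf; case: (tree_run_leaf h (tree_of_code T)) => [->|/Hleaf //].
by rewrite expn_gt0.
Qed.

Lemma good_treeW n T d e : d <= e -> good_tree n T d -> good_tree n T e.
Proof.
move=> le_de [wf_T le_T lt_T]; split=> [//||a /lt_T lt_a].
  exact: leq_trans le_T le_de.
by rewrite (leq_trans lt_a) // leq_exp2l.
Qed.

Lemma good_leaf n x d : x < 2 ^ d ->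
  exists T, good_tree n T d /\ forall w, tree_run (fapp w) (tree_of_code T) = x.
Proof.
move=> lt_x; exists (pickle (GenTree.Leaf x)); rewrite /good_tree /tree_of_code pickleK.
by split=> //; split=> // a; rewrite inE => /eqP ->.
Qed.

Lemma good_tree_of_dtree n d D (t : dtree nat) : asks_le n d t -> d <= D ->
  exists2 T, good_tree n T D & forall h, (forall v, v < n -> h v < n) ->
    drun h t < 2 ^ D -> tree_run h (tree_of_code T) = drun h t.
Proof.
move=> Ht le_dD; exists (pickle (to_tree n (2 ^ D).-1 t)).
  rewrite /good_tree /tree_of_code pickleK /=; split.
  - exact: wf_to_tree Ht.
  - exact: leq_trans (depth_to_tree _ Ht) le_dD.
  - by move=> a /leaves_to_tree; rewrite -ltnS prednK ?expn_gt0.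
move=> h hn lt_run; rewrite /tree_of_code pickleK /= (run_to_tree _ hn Ht).
by apply/minn_idPl; rewrite -ltnS prednK ?expn_gt0.
Qed.

Fixpoint dtuple A k : ('I_k -> dtree A) -> dtree ('I_k -> A) :=
  if k is k'.+1 then fun ts =>
    dbind (ts ord0) (fun a => dbind (dtuple (vtail ts)) (fun v => DLeaf (vcons a v)))
  else fun=> DLeaf vnil.

Lemma drun_dtuple A k h (ts : 'I_k -> dtree A) :
  drun h (dtuple ts) = fun i => drun h (ts i).
Proof.
elim: k ts => [|k IHk] ts /=; first by rewrite [RHS]vnilE.
by rewrite !drun_bind /= IHk [RHS]vcons_eta.
Qed.

Lemma asks_le_dtuple n A d k (ts : 'I_k -> dtree A) :
  (forall i, asks_le n d (ts i)) -> asks_le n (k * d) (dtuple ts).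
Proof.
elim: k ts => [|k IHk] ts Hts //=; rewrite mulSn; apply: asks_le_bind => // a.
by rewrite -[k * d]addn0; apply: asks_le_bind => //; apply: IHk => i; exact: Hts.
Qed.

(** * Oracle computations *)

Definition table_oracle r gamma m w : ('I_r -> nat) -> nat :=
  fun q => if vcode q < m then fapp (fapp gamma (vcode q)) w else 0.

Section Machine.
Variables (k r : nat) (P : machine k r).

Definition query (c : config P) : 'I_r -> nat :=
  fun i => tape_number (tapes c (QueryTape _ _ i)).

Lemma runS f x t : run P f x t.+1 = step f (run P f x t).
Proof. by []. Qed.

(** A step depends on the oracle through at most one value. *)
Lemma step_query f c : step f c = step (fun=> f (query c)) c.
Proof. by []. Qed.

Lemma read_number_lt s : read_number s < 2 ^ size s.
Proof.
elim: s => //= -[b|] s IHs; last by rewrite expn_gt0.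
by rewrite expnS; case: b; lia.
Qed.

Lemma size_tape_act a T b : head_pos T <= b -> size (cells T) <= b ->
  head_pos (tape_act a T) <= b.+1 /\ size (cells (tape_act a T)) <= b.+1.
Proof.
case: a T => [a mv] [p s] /= le_p le_s; split; first by case: mv => /=; lia.
by rewrite size_set_nth geq_max !ltnS le_p leqW.
Qed.

Definition written_tape (j : tape_name k r (work_tapes P)) : bool :=
  match j with QueryTape _ | OutputTape => true | _ => false end.

(** The machine writes at most one cell of these tapes per step.  The answer tape
    is different, because the oracle fills it in one step. *)
Lemma run_tape_size f x t j : written_tape j ->
  head_pos (tapes (run P f x t) j) <= t /\ size (cells (tapes (run P f x t) j)) <= t.
Proof.
move=> Hj; elim: t => [|t [IHp IHs]]; first by case: j Hj.
rewrite runS /step.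
case: ifP => _; first by split; exact: leqW.
case: ifP => _; last exact: size_tape_act.
by case: j Hj IHp IHs => //= *; split; exact: leqW.
Qed.

Lemma run_tape_number f x t j : written_tape j ->
  tape_number (tapes (run P f x t) j) < 2 ^ t.
Proof.
move=> Hj; have [_ le_t] := run_tape_size f x t Hj.
by rewrite (leq_trans (read_number_lt _)) // leq_exp2l.
Qed.

(** Query tapes have at most [t] cells during the first [t] steps. *)
Lemma eq_run f g x t :
  (forall q, (forall i, q i < 2 ^ t) -> f q = g q) -> run P f x t = run P g x t.
Proof.
move=> eq_fg; have : t <= t by [].
elim: {1 3 4}t => [//|s IHs lt_st].
rewrite runS.
rewrite [RHS]runS.
rewrite -(IHs (ltnW lt_st)).
rewrite step_query [RHS]step_query eq_fg // => i.
by apply: (leq_trans (run_tape_number f x s _)) => //; rewrite leq_exp2l // ltnW.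
Qed.

(** Asking for the value at the current query before every step, also when the
    machine is not in its query state, keeps the cost uniform: each step costs
    one oracle tree. *)
Fixpoint sim (O : ('I_r -> nat) -> dtree nat) (c : config P)
    (t : nat) : dtree (config P) :=
  if t is s.+1 then
    dbind (sim O c s) (fun c' =>
      dbind (O (query c')) (fun a => DLeaf (step (fun=> a) c')))
  else DLeaf c.

Lemma drun_sim h O f c t : (forall q, drun h (O q) = f q) ->
  drun h (sim O c t) = iter t (step f) c.
Proof. by move=> HO; elim: t => //= t IHt; rewrite !drun_bind /= IHt HO. Qed.

Lemma asks_le_sim n d O c t : (forall q, asks_le n d (O q)) ->
  asks_le n (t * d) (sim O c t).
Proof.
move=> HO; elim: t => //= t IHt; rewrite mulSnr; apply: asks_le_bind => // c'.
by rewrite -[d]addn0; exact: asks_le_bind.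
Qed.

End Machine.

(** For an algorithm: the inputs cost [k * d]; [exponent P + (k * d) ^ exponent P]
    bounds the number of steps, each step costs [d], and the output has at most
    one bit per step. *)
Definition cost r k (s : pv_symbol r k) (d : nat) : nat :=
  match s with
  | SymF => r * d + d
  | SymAlg k P => k * d + ((exponent P + (k * d) ^ exponent P) * d
                           + (exponent P + (k * d) ^ exponent P))
  end.

Lemma blen_le x d : x < 2 ^ d -> blen x <= d.
Proof. by move=> ?; rewrite /blen up_log_min. Qed.

Lemma time_bound_le r k (P : poly_time_algorithm k r) x d : (forall i, x i < 2 ^ d) ->
  time_bound P x <= exponent P + (k * d) ^ exponent P.
Proof.
move=> lt_x; rewrite /time_bound leq_add2l.
case: (posnP (exponent P)) => [->|e_gt0]; first by rewrite !expn0.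
rewrite leq_exp2r // /vlen -[k in leqRHS]card_ord -sum_nat_const.
by apply: leq_sum => i _; exact: blen_le.
Qed.

Lemma eq_pv_value r k (s : pv_symbol r k) f g x d : (forall i, x i < 2 ^ d) ->
  (forall q, (forall i, q i < 2 ^ cost s d) -> f q = g q) ->
  pv_value s f x = pv_value s g x.
Proof.
case: k / s x => [|k P] x lt_x eq_fg /=.
  by apply: eq_fg => i; rewrite (leq_trans (lt_x i)) // leq_exp2l //= leq_addl.
rewrite /alg_value (@eq_run _ _ _ f g) // => q lt_q; apply: eq_fg => i.
rewrite (leq_trans (lt_q i)) // leq_exp2l //=.
by rewrite (leq_trans (time_bound_le _ lt_x)) // addnA leq_addl.
Qed.

(** The program that computes the arguments, simulates the machine and reads off
    the output.  It is correct at samples where the arguments are short, because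
    the number of steps depends on them. *)
Lemma pv_dtree r k (s : pv_symbol r k) n d (ts : 'I_k -> dtree nat) O :
  (forall i, asks_le n d (ts i)) -> (forall q, asks_le n d (O q)) ->
  exists2 t, asks_le n (cost s d) t &
    forall h f, (forall i, drun h (ts i) < 2 ^ d) ->
      (forall q, drun h (O q) = f q /\ f q < 2 ^ d) ->
      drun h t = pv_value s f (fun i => drun h (ts i)) /\ drun h t < 2 ^ cost s d.
Proof.
case: k / s ts => [|k P] ts Hts HO /=.
  exists (dbind (dtuple ts) O).
    by apply: asks_le_bind => //; exact: asks_le_dtuple.
  move=> h f _ Hf; rewrite drun_bind drun_dtuple.
  have [-> lt_f] := Hf (fun i => drun h (ts i)); split=> //.
  by rewrite (leq_trans lt_f) // leq_exp2l // leq_addl.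
set tb := exponent P + (k * d) ^ exponent P.
(* The minimum only matters at leaves of the input trees that no sample reaches:
   there the number of steps could exceed the bound. *)
exists (dbind (dtuple ts) (fun x =>
  dbind (sim O (init (mach P) x) (minn (time_bound P x) tb))
    (fun c => DLeaf (tape_number (tapes c OutputTape))))).
  apply: asks_le_bind; first exact: asks_le_dtuple.
  move=> x; apply: (@asks_leW _ _ (minn (time_bound P x) tb * d + 0)).
    by rewrite addn0 (leq_trans _ (leq_addr _ _)) // leq_mul2r geq_minr orbT.
  by apply: asks_le_bind => //; exact: asks_le_sim.
move=> h f lt_ts Hf; rewrite !drun_bind drun_dtuple.
have /minn_idPl -> := time_bound_le P lt_ts.
rewrite (drun_sim _ _ (fun q => (Hf q).1)) /=; split=> //.
apply: (leq_trans (run_tape_number _ _ _ _)) => //; rewrite leq_exp2l //.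
by rewrite (leq_trans (time_bound_le P lt_ts)) // addnA leq_addl.
Qed.

(** A tree is chosen for every entry of the table, since which queries are asked
    depends on the sample. *)
Lemma pv_tree r k (s : pv_symbol r k) n d m gamma (T : 'I_k -> nat) :
  (forall i, good_tree n (T i) d) ->
  (forall j, j < m -> exists U, good_tree n U d /\
     forall w, bmem w (samples n) ->
       tree_run (fapp w) (tree_of_code U) = fapp (fapp gamma j) w) ->
  exists U, good_tree n U (cost s d) /\
    forall w, bmem w (samples n) ->
      tree_run (fapp w) (tree_of_code U) =
      pv_value s (table_oracle gamma m w)
        (fun i => tree_run (fapp w) (tree_of_code (T i))).
Proof.
move=> HT HU.
have /choice[U {}HU] : forall j, exists U, j < m -> good_tree n U d /\
     forall w, bmem w (samples n) ->
       tree_run (fapp w) (tree_of_code U) = fapp (fapp gamma j) w.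
  move=> j; case: (boolP (j < m)) => [/HU[U ?]|_]; last by exists 0.
  by exists U.
pose O (q : 'I_r -> nat) :=
  if vcode q < m then of_tree (tree_of_code (U (vcode q))) else DLeaf 0.
have [|q|t Ht run_t] := @pv_dtree r k s n d (fun i => of_tree (tree_of_code (T i))) O.
- by move=> i; have [? ? _] := HT i; exact: asks_le_of_tree.
- by rewrite /O; case: ifP => // /HU[[? ? _] _]; exact: asks_le_of_tree.
have [V good_V run_V] := good_tree_of_dtree Ht (leqnn _).
exists V; split=> // w Hw.
have [||eq_t lt_t] := run_t (fapp w) (table_oracle gamma m w).
- by move=> i; rewrite drun_of_tree; exact: good_tree_run (HT i).
- move=> q; rewrite /O /table_oracle.
  case: ifP => [/HU[good_U run_U]|_]; last by rewrite expn_gt0.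
  by rewrite drun_of_tree -run_U //; split=> //; exact: good_tree_run good_U.
rewrite run_V //; last by move=> v; exact: sample_bound.
by rewrite eq_t; congr (pv_value s _ _); apply/funext => i; rewrite drun_of_tree.
Qed.

(** [table_oracle] inside a single function of numbers, so that it is available
    as a function symbol in [M]. *)
Definition table_value r k (s : pv_symbol r k) (v : 'I_k.+3 -> nat) : nat :=
  pv_value s (table_oracle (v ord0) (vtail v ord0) (vtail (vtail v) ord0))
    (vtail (vtail (vtail v))).

Lemma table_valueE r k (s : pv_symbol r k) gamma m w x :
  table_value s (vcons gamma (vcons m (vcons w x))) =
  pv_value s (table_oracle gamma m w) x.
Proof. by rewrite /table_value !vtail_cons !vcons0. Qed.

(** Only short queries are asked, so that the two oracles need to agree only on
    codes of short tuples. *)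
Lemma eq_pv_table r k (s : pv_symbol r k) g gamma m w d x :
  (forall i, x i < 2 ^ d) ->
  (forall c, (forall i, decode r (cost s d) c i < 2 ^ cost s d) ->
     c = vcode (decode r (cost s d) c) ->
     (c < m -> fapp g c = fapp (fapp gamma c) w) /\ (~ c < m -> fapp g c = 0)) ->
  pv_value s (fun q => fapp g (vcode q)) x = pv_value s (table_oracle gamma m w) x.
Proof.
move=> lt_x Hg; apply: eq_pv_value lt_x _ => q lt_q.
have [lt_c eq_c] := @decodeP r (cost s d) (vcode q) (ex_intro2 _ _ q lt_q erefl).
have [Hlt Hge] := Hg _ lt_c eq_c.
by rewrite /table_oracle; case: ifP => [/Hlt|/negP/Hge].
Qed.

Lemma fapp_poly_bounded r g : poly_bounded (fun q : 'I_r -> nat => fapp g (vcode q)).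
Proof.
exists g => x; apply: leq_trans (leq_addr _ _); apply: blen_le.
rewrite /fapp; case E: [seq _ <- _ | _] => [|y s] /=; first by rewrite expn_gt0.
have : y \in [seq y <- iota 0 g | bmem (pairn (vcode x) y) g] by rewrite E mem_head.
rewrite mem_filter mem_iota add0n => /andP[_ /andP[_ lt_yg]].
by rewrite (ltn_trans lt_yg) // ltn_expl.
Qed.

(** * Roots *)

Lemma iroot_expn n t j : 0 < n -> j <= t -> iroot n t ^ j <= n.
Proof.
move=> n_gt0 le_jt; have [->|y_gt0] := posnP (iroot n t).
  by case: j {le_jt} => // j; rewrite exp0n.
apply: leq_trans (_ : iroot n t ^ t <= n); first by rewrite leq_pexp2l.
rewrite /iroot; apply: (big_ind (fun y => y ^ t <= n)) => //.
- by case: t {le_jt y_gt0} => // t; rewrite exp0n.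
- by move=> x y Hx Hy; rewrite /maxn; case: ifP.
Qed.

(** The witness is the largest exponent up to [n] for which [a ^ t] is at most
    [n]; in [M] this replaces an overspill argument. *)
Lemma iroot_largest n a : 0 < n -> a <= n -> exists t, a <= iroot n t /\
  forall s, s <= n -> a ^ s <= n -> s <= t.
Proof.
move=> n_gt0 le_an.
have H0 : a ^ (ord0 : 'I_n.+1) <= n by rewrite expn0.
case: (@arg_maxnP _ ord0 (fun t : 'I_n.+1 => a ^ t <= n) val H0) => t Ht t_max.
exists t; split=> [|s le_sn Hs]; last exact: (t_max (Ordinal (le_sn : s < n.+1))).
have lt_an : a < n.+1 by [].
by rewrite /iroot; apply: (@leq_bigmax_cond _ _ _ (Ordinal lt_an)).
Qed.

(** * Uniform bounds *)

(** Each index has a least admissible bound; [i] is an index at which this least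
    bound is the largest. *)
Lemma hardest_index (P : nat -> nat -> Prop) m : 0 < m ->
  (forall j, j < m -> exists d, P j d) ->
  (forall j d e, d <= e -> P j d -> P j e) ->
  exists i, i < m /\ forall j d, j < m -> P i d -> P j d.
Proof.
move=> m_gt0 HP monoP.
have /choice[f Hf] : forall j, exists d, j < m -> P j d /\ forall e, P j e -> d <= e.
  move=> j; case: (boolP (j < m)) => [/HP[d Pd]|_]; last by exists 0.
  have ex_d : exists d, `[< P j d >] by exists d; apply/asboolP.
  exists (ex_minn ex_d) => _; case: ex_minnP => e /asboolP Pe min_e.
  by split=> // e' Pe'; apply: min_e; apply/asboolP.
case: (@arg_maxnP _ (Ordinal m_gt0) predT (fun j : 'I_m => f j) isT) => i _ max_i.
exists i; split=> // j d lt_jm Pid; have [Pj _] := Hf _ lt_jm.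
have [_ /(_ _ Pid) le_d] := Hf _ (ltn_ord i).
by apply: monoP Pj; apply: leq_trans le_d; exact: (max_i (Ordinal lt_jm)).
Qed.

(** * The cut of small numbers *)

(** The shape of the following definitions is dictated by [transfer], which turns
    them into [tree_run], [good_tree] and [table_value]. *)
Definition tree_at M (I : structure Lall M) (T w : M) : M :=
  app2 I (fun c s => tree_run (fapp s) (tree_of_code c)) T w.

Definition good_at M (I : structure Lall M) (n T d : M) : Prop :=
  [/\ rel2 I (fun k c => tree_wf k (tree_of_code c)) n T,
      leM I (app1 I (fun c => tree_depth (tree_of_code c)) T) d &
      forall a, rel2 I (fun a c => a \in tree_leaves (tree_of_code c)) a T ->
        ltM I a (app2 I expn (app0 I 2) d)].

Definition table_at M (I : structure Lall M) r k (s : pv_symbol r k)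
    (gamma m w : M) (x : 'I_k -> M) : M :=
  @fint Lall M I k.+3 (table_value s) (vcons gamma (vcons m (vcons w x))).

Section Model.
Variables (M : Type) (I : structure Lall M).
Hypothesis true_theory :
  forall phi : formula Lall 0, sat stdN phi vnil -> sat I phi vnil.
Variable n : M.
Hypothesis n_nonstandard : nonstandard I n.

Lemma lt_standard j t : ltM I t (app0 I j) -> exists i, t = app0 I i.
Proof.
elim: j t => [|j IHj] t.
  suff H : forall t, ~ ltM I t (app0 I 0) by move/H.
  by transfer => t'; lia.
have : forall t, ltM I t (app0 I j.+1) -> t = app0 I j \/ ltM I t (app0 I j).
  by transfer => t'; lia.
by move=> H /H [->|/IHj //]; exists j.
Qed.

(** The standard numbers form an initial segment of [M]. *)
Lemma standard_le t j : nonstandard I t -> leM I (app0 I j) t.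
Proof.
move=> t_nst; apply: contrapT => nle.
have [|i] := @lt_standard j t; last exact: t_nst.
suff : forall t, ~ leM I (app0 I j) t -> ltM I t (app0 I j) by apply.
by transfer => t'; lia.
Qed.

(** A description of the numbers below the [t]-th root of [n] for a nonstandard [t]
    that does not mention [t], from which the closure properties are immediate. *)
Definition small (a : M) : Prop :=
  forall j, leM I (app2 I expn a (app0 I j)) n.

Lemma small_le a b : leM I a b -> small b -> small a.
Proof.
move=> le_ab Hb j.
suff : forall n a b, leM I a b -> leM I (app2 I expn b (app0 I j)) n ->
  leM I (app2 I expn a (app0 I j)) n by apply; [exact: le_ab|exact: Hb].
transfer => N x y le_xy; apply: leq_trans.
by case: j {Hb} => // j; rewrite leq_exp2r.
Qed.

Lemma small_standard c : small (app0 I c).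
Proof.
move=> j; have := standard_le (c ^ j) n_nonstandard.
suff -> : app2 I expn (app0 I c) (app0 I j) = app0 I (c ^ j) by [].
by transfer.
Qed.

Lemma small_exp a c : small a -> small (app2 I expn a (app0 I c)).
Proof.
move=> Ha j; have := Ha (c * j)%N.
suff -> : forall a, app2 I expn (app2 I expn a (app0 I c)) (app0 I j) =
  app2 I expn a (app0 I (c * j)) by [].
by transfer => x; rewrite expnM.
Qed.

Lemma leM_total a b : leM I a b \/ leM I b a.
Proof.
suff : forall a b, leM I a b \/ leM I b a by apply.
by transfer => x y; lia.
Qed.

Lemma small_mul a b : small a -> small b -> small (app2 I muln a b).
Proof.
suff sqr c : small c -> small (app2 I muln c c).
  move=> Ha Hb; case: (leM_total a b) => [le|le]; [move: (sqr _ Hb)|move: (sqr _ Ha)];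
    apply: small_le; move: a b le {Ha Hb}; transfer => x y; nia.
move=> Hc; apply: small_le (small_exp 2 Hc); move: c {Hc}.
by transfer => x; rewrite -mulnn.
Qed.

Lemma small_add a b : small a -> small b -> small (app2 I addn a b).
Proof.
suff twice c : small c -> small (app2 I addn c c).
  move=> Ha Hb; case: (leM_total a b) => [le|le]; [move: (twice _ Hb)|move: (twice _ Ha)];
    apply: small_le; move: a b le {Ha Hb}; transfer => x y; lia.
move=> Hc; apply: small_le (small_mul (small_standard 2) Hc); move: c {Hc}.
by transfer => x; lia.
Qed.

(** For a fixed symbol the cost is a polynomial with standard coefficients and a
    standard exponent. *)
Lemma small_cost r k (s : pv_symbol r k) d : small d -> small (app1 I (cost s) d).
Proof.
move=> Hd; case: k / s => [|k P].
  suff -> : forall d, app1 I (cost (SymF r)) d =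
      app2 I addn (app2 I muln (app0 I r) d) d.
    by apply: small_add => //; apply: small_mul => //; exact: small_standard.
  by transfer.
set kd := app2 I muln (app0 I k) d.
have Hkd : small kd by apply: small_mul => //; exact: small_standard.
set tb := app2 I addn (app0 I (exponent P)) (app2 I expn kd (app0 I (exponent P))).
have Htb : small tb by apply: small_add; [exact: small_standard|exact: small_exp].
suff -> : app1 I (cost (SymAlg P)) d = app2 I addn kd (app2 I addn (app2 I muln tb d) tb).
  by apply: small_add => //; apply: small_add => //; exact: small_mul.
rewrite /tb /kd; move: d {Hd kd Hkd tb Htb}.
by transfer.
Qed.

Lemma n_gt0 : ltM I (app0 I 0) n.
Proof.
have := standard_le 1 n_nonstandard.
suff : forall n, leM I (app0 I 1) n -> ltM I (app0 I 0) n by apply.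
by transfer.
Qed.

Lemma small_iroot t : nonstandard I t -> small (app2 I iroot n t).
Proof.
move=> t_nst j; have := standard_le j t_nst; have := n_gt0.
suff : forall n t, ltM I (app0 I 0) n -> leM I (app0 I j) t ->
  leM I (app2 I expn (app2 I iroot n t) (app0 I j)) n by apply.
by transfer => N y; exact: iroot_expn.
Qed.

(** The largest [t] up to [n] with [a ^ t] at most [n] exceeds every standard
    number, because all standard powers of [a] are at most [n]. *)
Lemma small_le_iroot a : small a ->
  exists2 t, nonstandard I t & leM I a (app2 I iroot n t).
Proof.
move=> Ha.
have [t [le_at t_max]] : exists t, leM I a (app2 I iroot n t) /\
    forall s, leM I s n -> leM I (app2 I expn a s) n -> leM I s t.
  have := n_gt0; have : leM I a n.
    suff <- : app2 I expn a (app0 I 1) = a by exact: Ha.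
    by move: a {Ha}; transfer => x; rewrite expn1.
  suff H : forall a n, leM I a n -> ltM I (app0 I 0) n -> exists t,
      leM I a (app2 I iroot n t) /\
      forall s, leM I s n -> leM I (app2 I expn a s) n -> leM I s t by exact: H.
  by transfer => x N le_x N_gt0; exact: iroot_largest.
exists t => // j eq_t.
have := t_max (app0 I j.+1) (standard_le _ n_nonstandard) (Ha _).
rewrite eq_t; suff : ~ leM I (app0 I j.+1) (app0 I j) by [].
by transfer; lia.
Qed.

Local Notation Mn := (Mn I n).
Local Notation pow2 d := (app2 I expn (app0 I 2) d).

Lemma Mn_small x : Mn x <-> exists2 d, small d & ltM I x (pow2 d).
Proof.
split=> [[t t_nst le_x]|[d Hd lt_x]].
  exists (app2 I addn (app2 I iroot n t) (app0 I 1)).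
    by apply: small_add; [exact: small_iroot|exact: small_standard].
  move: x (app2 I iroot n t) le_x; transfer => x y le_x.
  by rewrite (leq_ltn_trans le_x) // ltn_exp2l // addn1.
have [t t_nst le_d] := small_le_iroot Hd; exists t => //.
move: x d (app2 I iroot n t) lt_x le_d {Hd}; transfer => x d y lt_x le_d.
by rewrite (leq_trans (ltnW lt_x)) // leq_exp2l.
Qed.

Lemma Mn_pair x y : Mn x -> Mn y -> Mn (pairM I x y).
Proof.
move=> /Mn_small[d Hd lt_x] /Mn_small[e He lt_y]; apply/Mn_small.
exists (app2 I addn (app2 I addn (app2 I addn d e) (app2 I addn d e)) (app0 I 3)).
  have Hde := small_add Hd He.
  exact: small_add (small_add Hde Hde) (small_standard 3).
move: x y d e lt_x lt_y {Hd He}; transfer => x y d e lt_x lt_y.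
by apply: pairn_lt; [apply: leq_trans lt_x _|apply: leq_trans lt_y _];
  rewrite leq_exp2l // ?leq_addr ?leq_addl.
Qed.

Lemma good_atW T d e : leM I d e -> good_at I n T d -> good_at I n T e.
Proof.
suff H : forall n T d e, leM I d e -> good_at I n T d -> good_at I n T e by exact: H.
by rewrite /good_at; transfer => N U x y; exact: good_treeW.
Qed.

(** Every leaf of a tree in [Tnb] has its own small bound for the length of its
    label; the bound of the largest label works for all of them. *)
Lemma Tnb_good T : Tnb I n T <-> exists2 d, small d & good_at I n T d.
Proof.
split=> [[wf_T HL [t t_nst le_T]]|[d Hd [wf_T le_T lt_T]]].
  have [a [Ha a_max]] : exists a, (a = app0 I 0 \/
       rel2 I (fun a c => a \in tree_leaves (tree_of_code c)) a T) /\
     forall b, rel2 I (fun a c => a \in tree_leaves (tree_of_code c)) b T -> leM I b a.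
    move: T {wf_T HL le_T}; transfer => T.
    elim: (tree_leaves _) => [|b s [a [Ha a_max]]]; first by exists 0; split; [left|].
    exists (maxn a b); split=> [|c].
      rewrite /maxn; case: ifP => _; first by right; rewrite mem_head.
      by case: Ha => [|Ha]; [left|right; rewrite in_cons Ha orbT].
    by rewrite in_cons => /orP[/eqP ->|/a_max le_ca]; rewrite leq_max ?leqnn ?orbT ?le_ca.
  have /Mn_small[d Hd lt_a] : Mn a.
    case: Ha => [->|/HL //]; apply/Mn_small; exists (app0 I 0); first exact: small_standard.
    by transfer.
  exists (app2 I addn d (app2 I iroot n t)).
    by apply: small_add => //; exact: small_iroot.
  split=> //.
    by move: le_T; move: (app1 I _ T) (app2 I iroot n t) d {Hd lt_a};
      transfer => *; lia.
  move=> b /a_max le_ba; move: b a d (app2 I iroot n t) le_ba lt_a {Ha a_max le_T Hd}.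
  transfer => b a d y le_ba lt_a.
  by rewrite (leq_ltn_trans le_ba) // (leq_trans lt_a) // leq_exp2l // leq_addr.
split=> //; first by move=> a /lt_T lt_a; apply/Mn_small; exists d.
have [t t_nst le_d] := small_le_iroot Hd; exists t => //.
by move: le_T le_d; move: (app1 I _ T) d (app2 I iroot n t) {Hd lt_T};
  transfer => *; lia.
Qed.

Local Notation Omega := (Omega I n).
Local Notation Fnb := (@Fnb M I n).

Lemma Fnb_good alpha : Fnb alpha <->
  exists T d, [/\ small d, good_at I n T d & alpha = fun w => tree_at I T (sval w)].
Proof.
split=> [[T /Tnb_good[d Hd HT] ->]|[T [d [Hd HT ->]]]]; first by exists T, d.
by exists T => //; apply/Tnb_good; exists d.
Qed.

Lemma tree_at_lt T d w : good_at I n T d -> ltM I (tree_at I T w) (pow2 d).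
Proof.
suff H : forall n T d w, good_at I n T d -> ltM I (tree_at I T w) (pow2 d) by exact: H.
by rewrite /good_at /tree_at; transfer => N U x y; exact: good_tree_run.
Qed.

Lemma Fnb_const x : Mn x -> Fnb (fun=> x).
Proof.
move=> /Mn_small[d Hd lt_x]; apply/Fnb_good.
have [T [HT eq_x]] : exists T, good_at I n T d /\ forall w, tree_at I T w = x.
  suff H : forall n x d, ltM I x (pow2 d) ->
      exists T, good_at I n T d /\ forall w, tree_at I T w = x by exact: H.
  by rewrite /good_at /tree_at; transfer => N y e; exact: good_leaf.
by exists T, d; split=> //; apply/funext => w; rewrite eq_x.
Qed.

(** * Random functions as tables *)

Local Notation Om := (app1 I samples n).

Definition is_table (m gamma d : M) : Prop :=
  forall j, ltM I j m -> exists U, good_at I n U d /\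
    forall w, memM I w Om -> tree_at I U w = fappM I (fappM I gamma j) w.

(** The entries have small bounds one by one.  Since the table is coded, some
    entry needs the largest bound, and its small bound is a bound for all. *)
Lemma uniform_table m gamma :
  (forall j, ltM I j m -> Fnb (fun w => fappM I (fappM I gamma j) (sval w))) ->
  exists2 d, small d & is_table m gamma d.
Proof.
move=> Hgamma.
have row j : ltM I j m -> exists d, small d /\ exists U, good_at I n U d /\
    forall w, memM I w Om -> tree_at I U w = fappM I (fappM I gamma j) w.
  move=> /Hgamma/Fnb_good[U [d [Hd HU eqU]]]; exists d.
  split=> //; exists U; split=> // w Hw.
  by have := congr1 (fun f => f (exist _ w Hw)) eqU.
case: (pselect (ltM I (app0 I 0) m)) => [m_gt0|m_le0]; last first.
  exists (app0 I 0); first exact: small_standard.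
  move=> j; suff H : forall m j, ~ ltM I (app0 I 0) m -> ~ ltM I j m by move=> /H.
  by transfer => x y; lia.
have [i [lt_im Hi]] : exists i, ltM I i m /\ forall j d, ltM I j m ->
    (exists U, good_at I n U d /\
      forall w, memM I w Om -> tree_at I U w = fappM I (fappM I gamma i) w) ->
    exists U, good_at I n U d /\
      forall w, memM I w Om -> tree_at I U w = fappM I (fappM I gamma j) w.
  have row' j (lt_jm : ltM I j m) : exists d U, good_at I n U d /\
      forall w, memM I w Om -> tree_at I U w = fappM I (fappM I gamma j) w.
    by have [d [_ HU]] := row j lt_jm; exists d.
  suff H : forall n m gamma, ltM I (app0 I 0) m -> (forall j, ltM I j m ->
      exists d U, good_at I n U d /\ forall w, memM I w (app1 I samples n) ->
        tree_at I U w = fappM I (fappM I gamma j) w) ->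
    exists i, ltM I i m /\ forall j d, ltM I j m ->
      (exists U, good_at I n U d /\ forall w, memM I w (app1 I samples n) ->
        tree_at I U w = fappM I (fappM I gamma i) w) ->
      exists U, good_at I n U d /\ forall w, memM I w (app1 I samples n) ->
        tree_at I U w = fappM I (fappM I gamma j) w by exact: H.
  rewrite /good_at /tree_at; transfer => N x y x_gt0 Hrow.
  apply: (hardest_index x_gt0 Hrow) => j d e le_de [U [HU eqU]].
  by exists U; split=> //; exact: good_treeW HU.
by have [d [Hd HU]] := row i lt_im; exists d => // j lt_jm; exact: Hi HU.
Qed.

Definition tabulates r (Theta : Omega -> M) (m gamma : M) : Prop :=
  forall q : 'I_r -> M, (forall i, Mn (q i)) -> forall w : Omega,
    (ltM I (vcodeM I q) m ->
       fappM I (Theta w) (vcodeM I q) = fappM I (fappM I gamma (vcodeM I q)) (sval w)) /\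
    (~ ltM I (vcodeM I q) m -> fappM I (Theta w) (vcodeM I q) = app0 I 0).

(** Constants belong to [Fnb], so the defining property of [Gnb], stated for
    members of [Fnb], determines [Theta w] at every tuple from [Mn].  The
    reduction to fewer arguments by pairing the last two does not change the code
    of the tuple, so the table of the unary function at the end of the chain
    serves for [Theta]. *)
Lemma Gnb_table r Theta : Gnb (n := n) r Theta ->
  exists m gamma, (exists2 d, small d & is_table m gamma d) /\ @tabulates r Theta m gamma.
Proof.
elim: r Theta => [//|[_|r IHr]] Theta.
  move=> [_ [m [gamma [_ Hgamma HTheta]]]]; exists m, gamma.
  split; first exact: uniform_table.
  move=> q Hq w.
  have -> : vcodeM I q = q ord0.
    by transfer_with q => u; rewrite vcode1.
  have := HTheta _ (Fnb_const (Hq ord0)) w; rewrite /rapp.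
  have -> : vcodeM I (fun _ : 'I_1 => q ord0) = q ord0.
    by transfer_with q => u; rewrite vcode1.
  by [].
move=> [_ [Theta' /IHr[m [gamma [Htab HTheta']]] eqTheta]]; exists m, gamma; split=> //.
move=> q Hq w.
pose q' (i : 'I_r.+1) :=
  if i < r then q (inord i) else pairM I (q (inord r)) (q (inord r.+1)).
have Hq' i : Mn (q' i) by rewrite /q'; case: ifP => // _; exact: Mn_pair.
have eq_code : vcodeM I q = vcodeM I q'.
  by rewrite /q'; transfer_with q => u; exact: vcode_pair_last.
have := eqTheta _ (fun i => Fnb_const (Hq i)) => /(congr1 (fun f => f w)).
rewrite /rapp eq_code => ->.
have -> : (fun i => pair_last (fun j (_ : Omega) => q j) i w) = q'.
  by apply/funext => i; rewrite /pair_last /q'; case: ifP.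
exact: HTheta'.
Qed.

(** * Closure under the symbols of the language *)

Lemma common_bound k (P : 'I_k -> M -> Prop) :
  (forall i d e, leM I d e -> P i d -> P i e) ->
  (forall i, exists2 d, small d & P i d) -> exists2 d, small d & forall i, P i d.
Proof.
elim: k P => [|k IHk] P monoP HP.
  by exists (app0 I 0) => [|[]//]; exact: small_standard.
have [d Hd Pd] := HP ord0.
have [e He Pe] := IHk _ (fun i => @monoP (lift ord0 i)) (fun i => HP (lift ord0 i)).
exists (app2 I addn d e); first exact: small_add.
move=> i; case: (unliftP ord0 i) => [j|] ->.
  by apply: monoP (Pe j); move: d e {Hd Pd He Pe}; transfer => x y; lia.
by apply: monoP Pd; move: d e {Hd He Pe}; transfer => x y; lia.
Qed.

Lemma pv_tree_at r k (s : pv_symbol r k) (T : 'I_k -> M) d m gamma :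
  (forall i, good_at I n (T i) d) -> is_table m gamma d ->
  exists U, good_at I n U (app1 I (cost s) d) /\
    forall w, memM I w Om ->
      tree_at I U w = table_at I s gamma m w (fun i => tree_at I (T i) w).
Proof.
move=> HT Htab.
suff H : forall n d m gamma, (forall i, good_at I n (T i) d) ->
  (forall j, ltM I j m -> exists U, good_at I n U d /\ forall w, memM I w (app1 I samples n) ->
     tree_at I U w = fappM I (fappM I gamma j) w) ->
  exists U, good_at I n U (app1 I (cost s) d) /\ forall w, memM I w (app1 I samples n) ->
      tree_at I U w = table_at I s gamma m w (fun i => tree_at I (T i) w) by exact: H.
rewrite /good_at /tree_at /table_at; transfer_with T => u N x y z Hu Hrow.
have [U [HU eqU]] := pv_tree s Hu Hrow; exists U; split=> // w Hw.
by rewrite eqU // table_valueE.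
Qed.

(** The rules of the transfer bind single elements of [M], so the quantifier over
    tuples [q] in the hypothesis is first replaced by one over codes. *)
Lemma pv_symbol_table r k (s : pv_symbol r k) (x : 'I_k -> M) g gamma m w d :
  (forall i, ltM I (x i) (pow2 d)) ->
  (forall q : 'I_r -> M, (forall i, ltM I (q i) (pow2 (app1 I (cost s) d))) ->
     (ltM I (vcodeM I q) m ->
        fappM I g (vcodeM I q) = fappM I (fappM I gamma (vcodeM I q)) w) /\
     (~ ltM I (vcodeM I q) m -> fappM I g (vcodeM I q) = app0 I 0)) ->
  pv_symbolM I g s x = table_at I s gamma m w x.
Proof.
move=> lt_x Hg.
pose q c (i : 'I_r) := app2 I (fun d c => decode r (cost s d) c i) d c.
have {}Hg c : (forall i, ltM I (q c i) (pow2 (app1 I (cost s) d))) -> c = vcodeM I (q c) ->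
    (ltM I c m -> fappM I g c = fappM I (fappM I gamma c) w) /\
    (~ ltM I c m -> fappM I g c = app0 I 0).
  by move=> lt_q eq_c; have := Hg _ lt_q; rewrite -eq_c.
suff H : forall g gamma m w d, (forall i, ltM I (x i) (pow2 d)) ->
  (forall c, (forall i : 'I_r, ltM I (app2 I (fun d c => decode r (cost s d) c i) d c)
                          (pow2 (app1 I (cost s) d))) ->
     c = vcodeM I (fun i : 'I_r => app2 I (fun d c => decode r (cost s d) c i) d c) ->
    (ltM I c m -> fappM I g c = fappM I (fappM I gamma c) w) /\
    (~ ltM I c m -> fappM I g c = app0 I 0)) ->
  pv_symbolM I g s x = table_at I s gamma m w x by exact: H.
rewrite /pv_symbolM /table_at; transfer_with x => u g' gamma' m' w' d' lt_u Hg'.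
rewrite table_valueE vtail_cons vcons0.
exact: eq_pv_table lt_u Hg'.
Qed.

Lemma K_closedP r (Theta : Omega -> M) : Gnb (n := n) r Theta -> K_closed r Theta.
Proof.
move=> /Gnb_table[m [gamma [[d0 Hd0 Htab] HTheta]]] k s alpha Halpha.
have /choice[T HT] : forall i, exists T, (exists2 d, small d & good_at I n T d) /\
    alpha i = fun w => tree_at I T (sval w).
  by move=> i; have /Fnb_good[T [d [Hd HT eqT]]] := Halpha i; exists T; split=> //; exists d.
have [d Hd Hgood] := common_bound (fun i d e => @good_atW (T i) d e) (fun i => (HT i).1).
pose e := app2 I addn d d0.
have He : small e by exact: small_add.
have le_de : leM I d e by rewrite /e; move: (d) (d0); transfer => x y; lia.
have le_d0e : leM I d0 e by rewrite /e; move: (d) (d0); transfer => x y; lia.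
have Htab' : is_table m gamma e.
  by move=> j /Htab[U [HU eqU]]; exists U; split=> //; exact: good_atW HU.
have [U [HU eqU]] := pv_tree_at s (fun i => good_atW le_de (Hgood i)) Htab'.
apply/Fnb_good; exists U, (app1 I (cost s) e); split=> //; first exact: small_cost.
apply/funext => w; rewrite (eqU _ (svalP w)) /samplewise /=.
have -> : (fun i => alpha i w) = (fun i => tree_at I (T i) (sval w)).
  by apply/funext => i; rewrite (HT i).2.
apply: (@pv_symbol_table r k s _ _ _ _ _ e).
  by move=> i; apply: tree_at_lt; exact: good_atW le_de (Hgood i).
move=> q lt_q; apply: HTheta => i; apply/Mn_small.
by exists (app1 I (cost s) e) => //; exact: small_cost.
Qed.

(** * The Boolean algebra *)

Local Notation coded := (@coded_sets M I n).
Local Notation null := (@null_sets M I n).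
Local Notation cls := (@cls M I n).
Local Open Scope classical_set_scope.

Lemma coded0 : coded set0.
Proof.
have out x : ~ memM I x (app0 I 0) by move: x; transfer => x; rewrite /bmem div0n.
by exists (app0 I 0); split=> [x /out //|w]; split=> [/out|].
Qed.

Lemma codedT : coded setT.
Proof. by exists Om; split=> // w; split=> // _; exact: svalP w. Qed.

Lemma codedC P : coded P -> coded (~` P).
Proof.
move=> [A [_ HA]].
have [B HB] : exists B, forall x, memM I x B <-> memM I x Om /\ ~ memM I x A.
  by move: Om A {HA}; transfer => x y; exact: comprehension.
exists B; split=> [x /HB[]//|w]; rewrite HB /setC /= -HA.
by split=> [[]|] //; split=> //; exact: svalP w.
Qed.

Lemma codedI P Q : coded P -> coded Q -> coded (P `&` Q).
Proof.
move=> [A [HA0 HA]] [B [_ HB]].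
have [C HC] : exists C, forall x, memM I x C <-> memM I x A /\ memM I x B.
  by move: A B {HA0 HA HB}; transfer => x y; exact: (comprehension x (bmem^~ y)).
exists C; split=> [x /HC[/HA0]//|w]; rewrite HC HA HB //.
Qed.

Lemma codedU P Q : coded P -> coded Q -> coded (P `|` Q).
Proof.
move=> cP cQ; rewrite -[_ `|` _]setCK setCU.
by apply/codedC/codedI; exact: codedC.
Qed.

Lemma setYE (P Q : set Omega) : P `+` Q = (P `&` ~` Q) `|` (Q `&` ~` P).
Proof. by rewrite /setY !setDE. Qed.

Lemma codedY P Q : coded P -> coded Q -> coded (P `+` Q).
Proof.
move=> cP cQ; rewrite setYE.
by apply: codedU; apply: codedI => //; exact: codedC.
Qed.

(** Membership is decided by running two coded trees. *)
Lemma coded_eq alpha beta : Fnb alpha -> Fnb beta -> coded [set w | alpha w = beta w].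
Proof.
move=> /Fnb_good[T [_ [_ _ ->]]] /Fnb_good[U [_ [_ _ ->]]].
have [A HA] : exists A, forall x, memM I x A <-> memM I x Om /\ tree_at I T x = tree_at I U x.
  rewrite /tree_at; move: Om T U; transfer => x y z.
  exact: (comprehension x (fun w => tree_run (fapp w) (tree_of_code y) = _)).
exists A; split=> [x /HA[]//|w]; rewrite HA /=; split=> [[]//|]; split=> //; exact: svalP w.
Qed.

Lemma null_coded P : null P -> coded P.
Proof. by move=> [A HA _]; exists A. Qed.

(** Twice the required factor on [P] and on [Q] pays for both. *)
Lemma null_cover P Q R : null P -> null Q -> coded R -> R `<=` P `|` Q -> null R.
Proof.
move=> [A [A_in HA] A_small] [B [B_in HB] B_small] [C [C_in HC]] sub_R.
exists C => // k k_gt0.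
have k2_gt0 : 0 < k * 2 by rewrite muln_gt0 k_gt0.
have cover x : memM I x C -> memM I x A \/ memM I x B.
  move=> xC; pose w : Omega := exist _ x (C_in _ xC).
  by case: (sub_R w ((HC w).1 xC)) => [/HA|/HB]; [left|right].
have := cover; have := B_small _ k2_gt0; have := A_small _ k2_gt0.
suff H : forall Om A B C,
  ltM I (app2 I muln (app0 I (k * 2)) (app1 I bcard A)) (app1 I bcard Om) ->
  ltM I (app2 I muln (app0 I (k * 2)) (app1 I bcard B)) (app1 I bcard Om) ->
  (forall x, memM I x C -> memM I x A \/ memM I x B) ->
  ltM I (app2 I muln (app0 I k) (app1 I bcard C)) (app1 I bcard Om) by exact: H.
transfer => x a b c lt_a lt_b /bcard_cover; nia.
Qed.

(** The empty set is null because there is at least one sample. *)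
Lemma null0 : null set0.
Proof.
have [A HA] := coded0; have [A_in HA'] := HA; exists A => // k _.
have A_empty x : ~ memM I x A.
  by move=> xA; exact: (HA' (exist _ x (A_in _ xA))).1 xA.
have := standard_le 2 n_nonstandard.
suff H : forall n A, (forall x, ~ memM I x A) -> leM I (app0 I 2) n ->
   ltM I (app2 I muln (app0 I k) (app1 I bcard A)) (app1 I bcard (app1 I samples n))
  by exact: H.
transfer => N a a_empty /samples_gt0; apply: leq_trans.
rewrite ltnS (leq_trans (leq_mul (leqnn k) (_ : _ <= 0))) ?muln0 //.
rewrite leqNgt -has_count; apply/hasPn => x _; exact/negP.
Qed.

Lemma null_sub P Q : null P -> coded Q -> Q `<=` P -> null Q.
Proof. by move=> nP cQ sub; apply: null_cover nP null0 cQ _; rewrite setU0. Qed.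

Lemma nullU P Q : null P -> null Q -> null (P `|` Q).
Proof.
move=> nP nQ; have cPQ := codedU (null_coded nP) (null_coded nQ).
exact: (null_cover nP nQ cPQ (fun w Hw => Hw)).
Qed.

Lemma mem_cls P : coded P -> cls P P.
Proof. by move=> cP; split=> //; rewrite setYE setICr setU0; exact: null0. Qed.

Lemma eq_cls P Q : coded P -> coded Q -> null (P `+` Q) -> cls P = cls Q.
Proof.
move=> cP cQ nPQ; apply/seteqP; split=> R [cR nR]; split=> //.
  apply: null_cover nPQ nR (codedY cQ cR) _ => w; rewrite !setYE /setI /setU /setC /=.
  by case: (pselect (P w)); tauto.
apply: null_cover nPQ nR (codedY cP cR) _ => w; rewrite !setYE /setI /setU /setC /=.
by case: (pselect (Q w)); tauto.
Qed.

Lemma negB_cls P : coded P -> Defs.negB (cls P) = cls (~` P).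
Proof.
move=> cP; apply/seteqP; split=> [R [P' [cP' nP'] HR]|R HR]; last first.
  by exists P => //; exact: mem_cls.
rewrite (_ : cls (~` P) = cls (~` P')) //.
apply: eq_cls (codedC cP) (codedC cP') _; apply: null_sub nP' _ _.
  by apply: codedY; exact: codedC.
move=> w; rewrite !setYE /setI /setU /setC /=.
by case: (pselect (P w)); case: (pselect (P' w)); tauto.
Qed.

Lemma andB_cls P Q : coded P -> coded Q -> Defs.andB (cls P) (cls Q) = cls (P `&` Q).
Proof.
move=> cP cQ; apply/seteqP; split=> [R [P' [Q' [[cP' nP'] [cQ' nQ'] HR]]]|R HR]; last first.
  by exists P, Q; split=> //; exact: mem_cls.
rewrite (_ : cls (P `&` Q) = cls (P' `&` Q')) //.
apply: eq_cls (codedI cP cQ) (codedI cP' cQ') _; apply: null_cover nP' nQ' _ _.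
  by apply: codedY; exact: codedI.
move=> w; rewrite !setYE /setI /setU /setC /=.
by case: (pselect (P w)); case: (pselect (P' w)); tauto.
Qed.

Lemma orB_cls P Q : coded P -> coded Q -> Defs.orB (cls P) (cls Q) = cls (P `|` Q).
Proof.
move=> cP cQ; apply/seteqP; split=> [R [P' [Q' [[cP' nP'] [cQ' nQ'] HR]]]|R HR]; last first.
  by exists P, Q; split=> //; exact: mem_cls.
rewrite (_ : cls (P `|` Q) = cls (P' `|` Q')) //.
apply: eq_cls (codedU cP cQ) (codedU cP' cQ') _; apply: null_cover nP' nQ' _ _.
  by apply: codedY; exact: codedU.
move=> w; rewrite !setYE /setI /setU /setC /=.
by case: (pselect (P w)); case: (pselect (P' w)); tauto.
Qed.

(** The infimum is defined by choice among the greatest lower bounds, so it has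
    to be shown that any two of them have the same class. *)
Lemma infB_B1 : infB (n := n) [set B1 (n := n)] = B1 (n := n) :> @Bval M I n.
Proof.
have leB11 : leB (B1 (n := n)) (B1 (n := n) : @Bval M I n).
  exists setT, setT; split; try exact: mem_cls codedT.
  by rewrite setDv; exact: null0.
have glb1 : is_glb [set B1 (n := n)] (B1 (n := n) : @Bval M I n).
  split=> [|c -> //|d _ Hd]; last exact: Hd.
  by exists setT; first exact: codedT.
have [[P cP eqP] _ /(_ (B1 (n := n)))] :=
  xgetPex (B0 (n := n) : @Bval M I n) (ex_intro _ _ glb1).
rewrite /infB eqP; case.
- by exists setT; first exact: codedT.
- by move=> c ->.
move=> R [R' [[cR nR] [cR' nR'] nRR']].
apply: (eq_cls cP codedT).
apply: (null_cover (nullU nR nR') nRR' (codedY cP codedT)).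
move=> w; rewrite !setYE setDE /setI /setU /setC /=.
by case: (pselect (R w)); case: (pselect (R' w)); tauto.
Qed.

(** * Truth values *)

Section Truth.
Variables (r : nat) (Theta : Omega -> M).
Hypothesis closed : K_closed r Theta.
Local Notation S := (K_sample r Theta).

Lemma tvalue_teval m (v : 'I_m -> Omega -> M) t w :
  tvalue S v t w = teval (S w) (fun i => v i w) t.
Proof.
by elim: t => //= k s ts IH; rewrite /samplewise /=; congr pv_symbolM; apply/funext.
Qed.

Lemma tvalue_Fnb m (v : 'I_m -> Omega -> M) t :
  (forall i, Fnb (v i)) -> Fnb (tvalue S v t).
Proof. by move=> Hv; elim: t => //= k s ts IH; exact: closed. Qed.

Lemma truth_quantifier_free m (phi : formula (LPV r) m) (v : 'I_m -> Omega -> M) :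
  quantifier_free phi -> (forall i, Fnb (v i)) ->
  let P := [set w | sat (S w) phi (fun i => v i w)] in
  coded P /\ truth S phi v = cls P.
Proof.
elim: phi v => {m} /= [m t u v _ Hv|m k []|m p IHp v qf_p Hv
  |m p IHp q IHq v [qf_p qf_q] Hv|m p IHp q IHq v [qf_p qf_q] Hv|//|//].
- rewrite (_ : [set w | _] = [set w | tvalue S v t w = tvalue S v u w]).
    by split=> //; apply: coded_eq; exact: tvalue_Fnb.
  by apply/seteqP; split=> w /=; rewrite !tvalue_teval.
- have [cP ->] := IHp v qf_p Hv; rewrite negB_cls //.
  by split=> //; exact: codedC.
- have [cP ->] := IHp v qf_p Hv; have [cQ ->] := IHq v qf_q Hv; rewrite andB_cls //.
  by split=> //; exact: codedI.
- have [cP ->] := IHp v qf_p Hv; have [cQ ->] := IHq v qf_q Hv; rewrite orB_cls //.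
  by split=> //; exact: codedU.
Qed.

(** A universal quantifier over [Fnb] only instantiates the quantifier over [M] at
    each sample, so truth at every sample passes to the instances. *)
Lemma truth_universal m (phi : formula (LPV r) m) (v : 'I_m -> Omega -> M) :
  universal phi -> (forall i, Fnb (v i)) ->
  (forall w, sat (S w) phi (fun i => v i w)) -> truth S phi v = B1 (n := n).
Proof.
have qf_case k (psi : formula (LPV r) k) (u : 'I_k -> Omega -> M) :
    quantifier_free psi -> (forall i, Fnb (u i)) ->
    (forall w, sat (S w) psi (fun i => u i w)) -> truth S psi u = B1 (n := n).
  move=> qf Hu true_psi; have [_ ->] := truth_quantifier_free qf Hu; rewrite /B1.
  by congr Defs.cls; apply/seteqP; split=> w // _; exact: true_psi.
elim: phi v => {m}; try by move=> *; exact: qf_case.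
move=> m p IHp v univ_p Hv true_p /=.
rewrite (_ : [set _ | _ in _] = [set B1 (n := n)]) ?infB_B1 //.
have all1 alpha : Fnb alpha -> truth S p (vcons alpha v) = B1 (n := n).
  move=> Halpha; apply: IHp => // [i|w].
    by case: (unliftP ord0 i) => [j|] ->; rewrite ?vconsS ?vcons0.
  by rewrite (vcons_map (fun f => f w)); exact: true_p.
apply/seteqP; split=> b; first by case=> alpha Halpha <-; exact: all1.
move=> ->; have M0 : Mn (app0 I 0).
  by apply/Mn_small; exists (app0 I 0); [exact: small_standard|transfer].
by exists (fun=> app0 I 0); [exact: Fnb_const|apply: all1; exact: Fnb_const].
Qed.

End Truth.

(** * The axioms at a single sample *)

Section PVTransfer.
Variable r : nat.

Definition pv_at (g : M) : structure (LPV r) M :=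
  @Structure (LPV r) M (pv_symbolM I g) (fun k (R : void) => of_void _ R).

Definition coded_oracle (g : nat) : ('I_r -> nat) -> nat := fun q => fapp g (vcode q).

(** These are further rules of the transfer relation: they reflect the
    evaluation of arbitrary terms and formulas of the oracle language, with the
    code of the oracle as a parameter. *)
Lemma val_pv_term p v m g (x : 'I_m -> M) G F (t : term (LPV r) m) :
  val_at I p v g G -> (forall i, val_at I p v (x i) (F i)) ->
  val_at I p v (teval (pv_at g) x t)
    (fun u => teval (pv_std (coded_oracle (G u))) (fun i => F i u) t).
Proof.
move=> Hg Hx; elim: t => //= k s ts IH.
have := val_fint true_theory
  (fun v => pv_value s (fun q => fapp (v ord0) (vcode q)) (vtail v)) (val_vcons Hg IH).
by under [X in val_at _ _ _ _ X]funext do rewrite vtail_cons vcons0.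
Qed.

Lemma holds_pv_sat m (phi : formula (LPV r) m) p v g (x : 'I_m -> M) G F :
  val_at I p v g G -> (forall i, val_at I p v (x i) (F i)) ->
  holds_at I p v (sat (pv_at g) phi x)
    (fun u => sat (pv_std (coded_oracle (G u))) phi (fun i => F i u)).
Proof.
elim: phi p v x G F => {m} /= [m t t'|m k []|m q IHq|m q IHq q' IHq'|m q IHq q' IHq'
  |m q IHq|m q IHq] p v x G F Hg Hx.
- by apply: holds_eq => //; exact: val_pv_term.
- by apply: holds_not => //; exact: IHq.
- by apply: holds_and => //; [exact: IHq|exact: IHq'].
- by apply: holds_or => //; [exact: IHq|exact: IHq'].
- apply: (@holds_forall _ _ true_theory p v _
    (fun u => sat (pv_std (coded_oracle (G u.1))) q (vcons u.2 (fun i => F i u.1)))) => a.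
  apply: (IHq (bind_frame p) (vcons a v) (vcons a x) (fun u => G u.1)
    (fun i u => vcons u.2 (fun j => F j u.1) i)); first exact: val_weak.
  by apply: val_vcons => [|i]; [exact: val_here|exact: val_weak].
- apply: (@holds_exists _ _ true_theory p v _
    (fun u => sat (pv_std (coded_oracle (G u.1))) q (vcons u.2 (fun i => F i u.1)))) => a.
  apply: (IHq (bind_frame p) (vcons a v) (vcons a x) (fun u => G u.1)
    (fun i u => vcons u.2 (fun j => F j u.1) i)); first exact: val_weak.
  by apply: val_vcons => [|i]; [exact: val_here|exact: val_weak].
Qed.

(** The axiom is quantified over all coded oracles at once, the code being the only
    parameter of the transfer. *)
Lemma pv_axiom_sat phi g : forallPV1 phi -> sat (pv_at g) phi vnil.
Proof.
move=> [_ true_phi].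
have Hg := @val_tuple _ _ true_theory 1 (fun=> g) ord0.
have := holds_pv_sat phi Hg (@val_vnil _ I _ _).
move=> /(holds_elim true_theory); apply=> u.
by rewrite [fun i => _]vnilE; apply: true_phi; exact: fapp_poly_bounded.
Qed.

End PVTransfer.

End Model.

Theorem theorem6p13 (M : Type) (I : structure Lall M)
  (true_theory : forall phi : formula Lall 0, sat stdN phi vnil -> sat I phi vnil)
  (saturated : aleph1_saturated I)
  (n : M) (n_nonstandard : nonstandard I n)
  (n_pow2 : exists e : M, n = app2 I expn (app0 I 2) e)
  (r : nat) (Theta : Omega I n -> M) (Theta_G : Gnb (n := n) r Theta) :
  K_closed r Theta /\
  (forall phi : formula (LPV r) 0, forallPV1 phi -> K_truth Theta phi = B1 (n := n)).
Proof.
have closed := K_closedP true_theory n_nonstandard Theta_G; split=> // phi ax_phi.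
apply: (truth_universal true_theory n_nonstandard closed) => [|[]//|w].
  by case: ax_phi.
by rewrite [fun i => _]vnilE; exact: pv_axiom_sat.
Qed.
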